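(* Let $d \geq 3$ be an integer. There is a function $\varepsilon_d(n)$ with $\varepsilon_d(n) \to 0$ as $n \to \infty$ such that for every positive integer $n$ there is a subset $A$ of the lattice cube $[n]^d=\{1,\dots,n\}^d$ with $|A| \geq n^{\frac{3}{d+1} - \varepsilon_d(n)}$ such that no $d+2$ points of $A$ lie on a common sphere and no $d+2$ points of $A$ lie on a common hyperplane.
   Context: $[n]=\{1,\dots,n\}$. A sphere means a $(d-1)$-dimensional sphere in $\mathbb{R}^d$; a hyperplane means an affine hyperplane in $\mathbb{R}^d$. The bound $n^{\frac{3}{d+1}-o(1)}$ is for fixed $d$ as $n\to\infty$. *)

(* Defs.v *)
From HB Require Import structures.
From mathcomp Require Import all_boot all_order all_algebra.
From mathcomp Require Import all_classical all_reals all_analysis.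
Set Implicit Arguments. Unset Strict Implicit. Unset Printing Implicit Defensive.
Import Order.TTheory GRing.Theory Num.Theory.
Local Open Scope ring_scope.

(* A point of the lattice cube [n]^d: coordinate i is (x i).+1 in {1..n}. *)
Definition cube_pt (d n : nat) := {ffun 'I_d -> 'I_n}.

Definition embed (R : realType) (d n : nat) (x : cube_pt d n) : 'rV[R]_d :=
  \row_(i < d) ((x i).+1)%:R.

Definition on_sphere (R : realType) (d : nat) (c : 'rV[R]_d) (r : R) (p : 'rV[R]_d) :=
  \sum_(i < d) (p 0 i - c 0 i) ^+ 2 = r ^+ 2.

Definition on_hyperplane (R : realType) (d : nat) (a : 'rV[R]_d) (b : R) (p : 'rV[R]_d) :=
  \sum_(i < d) a 0 i * p 0 i = b.

Definition no_cospherical (R : realType) (d n : nat) (A : {set cube_pt d n}) :=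
  forall S : {set cube_pt d n}, S \subset A -> #|S| = (d + 2)%N ->
    ~ exists (c : 'rV[R]_d) (r : R), 0 < r /\
        forall x, x \in S -> on_sphere c r (embed R x).

Definition no_cohyperplanar (R : realType) (d n : nat) (A : {set cube_pt d n}) :=
  forall S : {set cube_pt d n}, S \subset A -> #|S| = (d + 2)%N ->
    ~ exists (a : 'rV[R]_d) (b : R), a != 0 /\
        forall x, x \in S -> on_hyperplane a b (embed R x).

(* Main.v *)
(* Proof idea.  A random subset of [n]^d, thinned by removing one point from each
   bad (d+2)-subset it contains, is large enough as soon as a random (d+2)-tuple
   x_0, ..., x_(d+1) is cospherical or cohyperplanar with probability n^(-3+o(1)).
   Put z_i = x_i - x_0, let Z have rows z_1, ..., z_d, and D = det Z.

   If D <> 0, the sphere through x_0, ..., x_d has equation D |z|^2 = z.w with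
   w = adj(Z) (|z_i|^2)_i.  Its integer points z satisfy D | z.w, which defines a
   lattice containing the d independent vectors z_i, so the box contains only
   O(n^d gcd(D, w_1) / |D|) of them; it also contains at most n^(d-2+o(1)) of them, by
   the divisor bound for sums of two squares.  It remains to show that
   min(n, n^d gcd(D, w_1) / |D|) has mean n^o(1).  As functions of the first
   coordinate s of z_d, D = N s + e and w_1 = N s^2 + f, so gcd(D, w_1) divides
   R = e^2 + N f, which does not involve s.  For each of the n^o(1) divisors g of R, the
   values of D / g lie in an arithmetic progression of difference N / gcd(N, g), and
   summing over s bounds the mean by that of min(n, n^(d-1) gcd(N, e) / |N|); averaging
   over the second coordinate of z_d replaces e by another (d-1)-minor N'.  This is the
   same problem for the (d-1)-minor N, and induction applies.

   The estimate for gcd(N, N') / |N| also controls the hyperplane case: the hyperplane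
   through x_0, ..., x_(d-1) has normal vector (N, N', ...), hence it contains at most
   n^(d-2) (1 + n gcd(N, N') / |N|) points of the box. *)

Require Import Defs.
From HB Require Import structures.
From mathcomp Require Import all_boot all_order all_fingroup all_algebra.
From mathcomp Require Import zify ring lra.
Import Order.TTheory GRing.Theory Num.Theory.
Set Implicit Arguments. Unset Strict Implicit. Unset Printing Implicit Defensive.
Local Open Scope ring_scope.

(** * The divisor function and sums of two squares *)

Definition tau (m : nat) : nat := size (divisors m).

Lemma size_le_inj (S T : eqType) (f : S -> T) (s : seq S) (t : seq T) :
  uniq s -> {in s &, injective f} -> (forall x, x \in s -> f x \in t) ->
  (size s <= size t)%N.
Proof.
move=> us injf ft; rewrite -(size_map f); apply: uniq_leq_size.
  by rewrite map_inj_in_uniq.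
by move=> _ /mapP[x xs ->]; exact: ft.
Qed.

Lemma size_fibers (S T : eqType) (f : S -> T) (s : seq S) (t : seq T) (k : nat) :
  (forall x, x \in s -> f x \in t) ->
  (forall u, u \in t -> (count (fun x => f x == u) s <= k)%N) ->
  (size s <= size t * k)%N.
Proof.
elim: t s => [|u t IH] s ft kt.
  by case: s ft {kt} => // x s /(_ x); rewrite mem_head => /(_ isT).
rewrite -(count_predC (fun x => f x == u)) mulSn leq_add ?kt ?mem_head //.
rewrite -size_filter; apply: IH => [x|v vt].
  rewrite mem_filter /= => /andP[fxu xs].
  by have := ft x xs; rewrite inE (negbTE fxu).
rewrite count_filter (leq_trans _ (kt v _)) ?inE ?vt ?orbT //.
by apply: sub_count => x /= /andP[].
Qed.

Lemma tau_gt0 m : (0 < m)%N -> (0 < tau m)%N.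
Proof. by move=> m0; rewrite /tau; case: divisors (divisors_id m0). Qed.

Lemma tau_dvd d m : (0 < m)%N -> (d %| m)%N -> (tau d <= tau m)%N.
Proof.
move=> m0 dm; apply: uniq_leq_size; first exact: divisors_uniq.
have d0 := dvdn_gt0 m0 dm.
by move=> x; rewrite -!dvdn_divisors // => /dvdn_trans; apply.
Qed.

(** A divisor [d] of [a * b] is recovered from [gcdn d a] and [d %/ gcdn d a]; the latter is coprime
    to [a %/ gcdn d a] and therefore divides [b]. *)
Lemma tau_mul a b : (0 < a)%N -> (0 < b)%N -> (tau (a * b) <= tau a * tau b)%N.
Proof.
move=> a0 b0; rewrite /tau -(size_allpairs (@pair nat nat)).
have ab0 : (0 < a * b)%N by rewrite muln_gt0 a0.
apply: (@size_le_inj _ _ (fun d => (gcdn d a, d %/ gcdn d a)))%N => /=.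
- exact: divisors_uniq.
- move=> d e _ _ [e1 e2].
  by rewrite -(divnK (dvdn_gcdl d a)) -(divnK (dvdn_gcdl e a)) e2 e1.
move=> d; rewrite -dvdn_divisors // => dab; apply: allpairs_f.
  by rewrite -dvdn_divisors // dvdn_gcdr.
have g0 : (0 < gcdn d a)%N by rewrite gcdn_gt0 a0 orbT.
rewrite -dvdn_divisors // -(@Gauss_dvdr _ (a %/ gcdn d a)).
  by rewrite -(@dvdn_pmul2r (gcdn d a)) // divnK ?dvdn_gcdl // mulnAC divnK ?dvdn_gcdr.
by rewrite /coprime -(eqn_pmul2r g0) muln_gcdl !divnK ?dvdn_gcdl ?dvdn_gcdr // mul1n.
Qed.

Lemma tau_pfactor p e : prime p -> (tau (p ^ e) <= e.+1)%N.
Proof.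
move=> pp; rewrite /tau -(size_iota 0 e.+1) -[X in (_ <= X)%N](size_map (expn p)).
apply: uniq_leq_size; first exact: divisors_uniq.
move=> d; rewrite -dvdn_divisors ?expn_gt0 ?prime_gt0 // => /dvdn_pfactor.
by case=> // m me ->; apply: map_f; rewrite mem_iota.
Qed.

Lemma succ_exp_le (k e : nat) : (0 < k)%N -> (e.+1 ^ k <= k ^ k * 2 ^ e)%N.
Proof.
move=> k0; apply: (@leq_trans ((k * 2 ^ (e %/ k)) ^ k)%N).
  rewrite leq_exp2r //; apply: (@leq_trans (k * (e %/ k).+1)%N).
    by rewrite {1}(divn_eq e k) mulnS mulnC addnC -addSn leq_add2r ltn_pmod.
  by rewrite leq_mul2l ltn_expl ?orbT.
by rewrite expnMn -expnM leq_mul2l leq_exp2l // leq_divM orbT.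
Qed.

(** The divisor bound tau(m) = O(m^(1/k)). A prime p >= 2^k with exponent e satisfies (e+1)^k <=
    2^(ek) <= p^e, and each of the at most 2^k smaller primes costs a factor k^k by
    [succ_exp_le]. *)
Lemma tau_bound (k : nat) : (0 < k)%N ->
  exists2 C, (0 < C)%N & forall m, (0 < m)%N -> (tau m ^ k <= C * m)%N.
Proof.
move=> k0; exists ((k ^ k) ^ (2 ^ k))%N => [|m m0]; first by rewrite !expn_gt0 k0.
have tle : (tau m <= \prod_(p <- primes m) (logn p m).+1)%N.
  rewrite [X in (tau X <= _)%N](prod_prime_decomp m0) prime_decompE big_map /=.
  have := all_prime_primes m; elim: (primes m) => [|p s IH] /=.
    by rewrite !big_nil.
  move=> /andP[pp ps]; rewrite !big_cons.
  have s0 : (0 < \prod_(q <- s) q ^ logn q m)%N.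
    rewrite big_seq; apply: prodn_cond_gt0 => q /(allP ps) /prime_gt0 q0.
    by rewrite expn_gt0 q0.
  have p0 : (0 < p ^ logn p m)%N by rewrite expn_gt0 prime_gt0.
  apply: leq_trans (tau_mul p0 s0) _.
  by rewrite leq_mul ?tau_pfactor ?IH.
have kk0 : (0 < k ^ k)%N by rewrite expn_gt0 k0.
pose c p := if (p < 2 ^ k)%N then (k ^ k)%N else 1%N.
apply: (@leq_trans ((\prod_(p <- primes m) (logn p m).+1) ^ k)%N).
  by rewrite leq_exp2r.
apply: (@leq_trans (\prod_(p <- primes m) (c p * p ^ logn p m))%N).
  rewrite (big_morph (expn^~ k) (fun x y => expnMn x y k) (exp1n k)).
  rewrite big_seq [X in (_ <= X)%N]big_seq; apply: leq_prod => p.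
  rewrite mem_primes => /and3P[pp _ _]; rewrite /c; case: ltnP => pk.
    apply: leq_trans (succ_exp_le _ k0) _.
    rewrite leq_mul //; case: (logn p m) => // e.
    by rewrite leq_exp2r // prime_gt1.
  rewrite mul1n; apply: leq_trans (_ : (2 ^ (logn p m)) ^ k <= _)%N.
    by rewrite leq_exp2r // ltn_expl.
  by rewrite -expnM mulnC expnM; case: (logn p m) => // e; rewrite leq_exp2r.
rewrite big_split /= leq_mul //.
  rewrite /c -big_mkcond /= big_const_seq iter_muln_1 leq_pexp2l //.
  rewrite -size_filter -[X in (_ <= X)%N](size_iota 0); apply: uniq_leq_size.
    by rewrite filter_uniq // primes_uniq.
  by move=> p; rewrite mem_filter mem_iota => /andP[].
by rewrite [X in (_ <= X)%N](prod_prime_decomp m0) prime_decompE big_map.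
Qed.

Lemma coprime_dvd_sumsq (X Y M g : int) : X ^+ 2 + Y ^+ 2 = M -> coprimez X Y ->
  (g %| M)%Z -> coprimez g X /\ coprimez g Y.
Proof.
have c (x y : int) : coprimez x y -> coprimez (x ^+ 2 + y ^+ 2) x.
  by move=> cxy; rewrite coprimez_sym /coprimez expr2 gcdzMDl; apply: coprimezXr.
move=> <- cXY gM; split; first exact: coprimez_dvdl gM (c _ _ cXY).
by rewrite addrC in gM; apply: coprimez_dvdl gM (c _ _ _); rewrite coprimez_sym.
Qed.

(* In Z[i]: the gcd g of M and X Y0 - X0 Y determines, up to a factor 2, which prime
   factors of X + iY are shared with X0 + iY0, the others being conjugate to those of
   X0 + iY0; hence two representations with the same g have cross product divisible by
   M / 2. *)
Lemma cross_dvd (M X0 Y0 X Y X1 Y1 : int) : M != 0 ->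
  X0 ^+ 2 + Y0 ^+ 2 = M -> X ^+ 2 + Y ^+ 2 = M -> X1 ^+ 2 + Y1 ^+ 2 = M ->
  coprimez X0 Y0 -> coprimez X Y -> 
  gcdz M (X * Y0 - X0 * Y) = gcdz M (X1 * Y0 - X0 * Y1) ->
  (M %| 2 * (X * Y1 - X1 * Y))%Z.
Proof.
move=> M0 e0 e e1 c0 c.
set A := X * Y0 - X0 * Y; set A1 := X1 * Y0 - X0 * Y1; set C := X * Y1 - X1 * Y.
set S := X * Y0 + X0 * Y; set S1 := X1 * Y0 + X0 * Y1.
set g := gcdz M A => gE.
have gM : (g %| M)%Z by exact: dvdz_gcdl.
have g0 : g != 0 by rewrite gcdz_eq0 (negbTE M0).
pose h := (M %/ g)%Z; have Mgh : M = h * g by rewrite divzK.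
have Bez D : (D %| X0 * C)%Z -> (D %| Y0 * C)%Z -> (D %| C)%Z.
  move=> dx dy; have [[u v] /= uv] := coprimezP _ _ c0.
  by rewrite -[C]mul1r -uv mulrDl rpredD // -mulrA dvdz_mull.
have gC : (g %| C)%Z.
  have gA : (g %| A)%Z by exact: dvdz_gcdr.
  have gA1 : (g %| A1)%Z by rewrite gE dvdz_gcdr.
  apply: Bez.
    have -> : X0 * C = A * X1 - A1 * X by rewrite /A /A1 /C; ring.
    by rewrite rpredB // dvdz_mulr.
  have -> : Y0 * C = A * Y1 - A1 * Y by rewrite /A /A1 /C; ring.
  by rewrite rpredB // dvdz_mulr.
(* With a = x Y0 - X0 y, the product a (x Y0 + X0 y) equals M (Y0^2 - y^2). As h = M / g is coprime
   to a / g, it must divide the other factor. *)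
have hS_ (x y : int) : x ^+ 2 + y ^+ 2 = M -> gcdz M (x * Y0 - X0 * y) = g ->
    (h %| x * Y0 + X0 * y)%Z.
  move=> exy gxy; set a := x * Y0 - X0 * y in gxy *.
  have ga : (g %| a)%Z by rewrite -gxy dvdz_gcdr.
  rewrite -(@Gauss_dvdzr _ (a %/ g)%Z).
    rewrite -(@dvdz_mul2r g) // -Mgh mulrAC divzK //.
    have -> : a * (x * Y0 + X0 * y) = M * (Y0 ^+ 2 - y ^+ 2).
      have -> : a * (x * Y0 + X0 * y) = x ^+ 2 * Y0 ^+ 2 - X0 ^+ 2 * y ^+ 2.
        by rewrite /a; ring.
      have -> : x ^+ 2 = M - y ^+ 2 by rewrite -exy addrK.
      have -> : X0 ^+ 2 = M - Y0 ^+ 2 by rewrite -e0 addrK.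
      by ring.
    by rewrite dvdz_mulr.
  apply/eqP/(mulIf g0); rewrite mul1r.
  have g_ge0 : 0 <= g by [].
  have -> : gcdz h (a %/ g)%Z * g = gcdz (h * g) ((a %/ g)%Z * g).
    by rewrite -mulz_gcdl gez0_abs.
  by rewrite divzK // -Mgh gxy.
have hC : (h %| C)%Z.
  have hS : (h %| S)%Z by apply: hS_.
  have hS1 : (h %| S1)%Z by apply: hS_.
  apply: Bez.
    have -> : X0 * C = S1 * X - S * X1 by rewrite /S /S1 /C; ring.
    by rewrite rpredB // dvdz_mulr.
  have -> : Y0 * C = S * Y1 - S1 * Y by rewrite /S /S1 /C; ring.
  by rewrite rpredB // dvdz_mulr.
have [[u v] /= uv] : {uv | uv.1 * g + uv.2 * h = gcdz g h}.
  by have [u [v e']] := Bezoutz g h; exists (u, v).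
(* gcd(g, h) divides A + S = 2 X Y0 and is coprime to X and to Y0. Since g and h both divide C, it
   follows that M = g h divides 2 C. *)
have g2 : (gcdz g h %| (2 : int)%R)%Z.
  have kM : (gcdz g h %| M)%Z by apply: dvdz_trans (dvdz_gcdl _ _) gM.
  have [_ cY0] := coprime_dvd_sumsq e0 c0 kM.
  have [cX _] := coprime_dvd_sumsq e c kM.
  rewrite -(Gauss_dvdzl _ cY0) -(Gauss_dvdzl _ cX).
  have -> : 2 * Y0 * X = A + S by rewrite /A /S; ring.
  rewrite rpredD //; first by apply: dvdz_trans (dvdz_gcdl _ _) (dvdz_gcdr _ _).
  by apply: dvdz_trans (dvdz_gcdr _ _) (hS_ _ _ _ _).
have /dvdzP[k ->] := g2; rewrite -mulrA dvdz_mull // -uv mulrDl rpredD //.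
  by rewrite -mulrA dvdz_mull // Mgh mulrC dvdz_mul.
by rewrite -mulrA dvdz_mull // Mgh dvdz_mul.
Qed.

Lemma sqr_sign_inj (x y : int) : x ^+ 2 = y ^+ 2 -> (0 <= x) = (0 <= y) -> x = y.
Proof. by move/eqP; rewrite eqf_sqr => /orP[/eqP //|/eqP ->]; lia. Qed.

Lemma abs_le2 (j m c : int) : 0 < m -> `|c| <= m -> j * m = 2 * c ->
  j \in [:: -2; -1; 0; 1; 2].
Proof.
move=> m0 cm jm; suff : -2 <= j <= 2 by rewrite !inE; lia.
by apply/andP; split; rewrite -(ler_pM2r m0) jm; lia.
Qed.

(** Fix a first pair [p0] and split by the gcd of [cross_dvd], which takes at most tau(M) values.
    Inside a class with representative q, a pair is determined by its cross product j M / 2 with q,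
    where |j| <= 2, and by the sign of its dot product with q: 5 * 2 = 10 choices. *)
Lemma size_coprime_sumsq (M : nat) (s : seq (int * int)) : (0 < M)%N -> uniq s ->
  (forall p, p \in s -> p.1 ^+ 2 + p.2 ^+ 2 = M%:Z /\ coprimez p.1 p.2) ->
  (size s <= tau M * 10)%N.
Proof.
case: s => // p0 s' M0; set s := p0 :: s' => us sP.
have M0' : M%:Z != 0 by lia.
have [e0 c0] := sP _ (mem_head _ _).
pose f (p : int * int) := gcdn M `|(p.1 * p0.2 - p0.1 * p.2)%R|.
apply: (@size_fibers _ _ f) => [p _|g _].
  by rewrite -dvdn_divisors // dvdn_gcdl.
rewrite -size_filter; case Es: [seq x <- s | f x == g] => [//|q r]; rewrite -Es.
have /[!mem_filter]/andP[/eqP fq qs] : q \in [seq x <- s | f x == g].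
  by rewrite Es mem_head.
have [eq cq] := sP _ qs.
pose cr (p : int * int) := q.1 * p.2 - p.1 * q.2.
pose dt (p : int * int) := q.1 * p.1 + q.2 * p.2.
have crdt p : p \in [seq x <- s | f x == g] ->
    [/\ cr p ^+ 2 + dt p ^+ 2 = M%:Z ^+ 2 & (M %| 2 * cr p)%Z].
  rewrite mem_filter => /andP[/eqP fp /sP[ep cp]]; split.
    by rewrite [in RHS]expr2 -{1}eq -ep /cr /dt; ring.
  by apply: (cross_dvd M0' e0 eq ep c0 cq); rewrite /gcdz -/(f q) -/(f p) fq fp.
apply: (@size_le_inj _ _ (fun p => ((2 * cr p %/ M%:Z)%Z, 0 <= dt p)) _
  [seq (x, b) | x <- [:: -2; -1; 0; 1; 2 : int], b <- [:: true; false]]).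
- by rewrite filter_uniq.
- move=> p p' sp sp'; have [ep dp] := crdt _ sp; have [ep' dp'] := crdt _ sp'.
  case=> e1 e2; have ecr : cr p = cr p'.
    by apply: (@mulfI int 2) => //; rewrite -(divzK dp) e1 divzK.
  have edt : dt p = dt p'.
    apply: sqr_sign_inj e2; apply: (@addrI _ (cr p ^+ 2)).
    by rewrite ep ecr ep'.
  have M1 v : M%:Z * v.1 = dt v * q.1 - cr v * q.2 by rewrite -eq /dt /cr; ring.
  have M2 v : M%:Z * v.2 = dt v * q.2 + cr v * q.1 by rewrite -eq /dt /cr; ring.
  rewrite (surjective_pairing p) (surjective_pairing p'); congr (_, _);
    by apply: (mulfI M0'); rewrite ?M1 ?M2 ecr edt.
move=> p sp; have [ep dp] := crdt _ sp; apply: allpairs_f; last by case: (0 <= _).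
apply: abs_le2 (divzK dp); first by rewrite ltz_nat.
by rewrite -ler_sqr ?nnegrE // real_normK ?num_real // -ep lerDl sqr_ge0.
Qed.

(** Dividing a pair by its gcd g, where g^2 divides M, leaves a coprime representation of M / g^2;
    there are at most tau(M) values of g. *)
Lemma size_sumsq (M : nat) (s : seq (int * int)) : (0 < M)%N -> uniq s ->
  (forall p, p \in s -> p.1 ^+ 2 + p.2 ^+ 2 = M%:Z) ->
  (size s <= tau M * (tau M * 10))%N.
Proof.
move=> M0 us sP.
pose f (p : int * int) := gcdn `|p.1| `|p.2|.
have fP p : p \in s -> [/\ (0 < f p)%N, (f p ^ 2 %| M)%N &
    exists a b : int, [/\ p = (a * (f p)%:Z, b * (f p)%:Z), coprimez a b
      & a ^+ 2 + b ^+ 2 = (M %/ f p ^ 2)%N%:Z]].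
  move=> ps; have pM := sP p ps.
  have f0 : (0 < f p)%N.
    rewrite gcdn_gt0 !absz_gt0 -negb_and; apply/negP => /andP[/eqP p1 /eqP p2].
    by move: pM; rewrite p1 p2 expr0n addr0; lia.
  have [/dvdzP[a pa] /dvdzP[b pb]] : (f p %| p.1)%Z /\ (f p %| p.2)%Z.
    by split; [exact: dvdn_gcdl | exact: dvdn_gcdr].
  have eM : M = ((`|a| ^ 2 + `|b| ^ 2)%N * f p ^ 2)%N.
    apply/eqP; rewrite -(eqr_nat int) natrM natrD !natrX !natz -pM pa pb.
    by rewrite !abszE !real_normK ?num_real // !exprMn mulrDl.
  split=> //; first by rewrite eM dvdn_mull.
  exists a, b; split; first by rewrite -pa -pb; case: (p).
    have f0' : (f p)%:Z != 0 by lia.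
    apply/eqP/(mulIf f0'); rewrite mul1r.
    by rewrite -{1}[f p]absz_nat mulz_gcdl -pa -pb.
  rewrite {1}eM mulnK ?expn_gt0 ?f0 // PoszD -!natz !natrX !natz !abszE.
  by rewrite !real_normK ?num_real.
apply: (@size_fibers _ _ f) => [p ps|g _].
  have [_ fM _] := fP _ ps; rewrite -dvdn_divisors // (dvdn_trans _ fM) //.
  by rewrite dvdn_mulr.
rewrite -size_filter; set t := filter _ _.
have [->//|t0] := eqVneq t [::].
have [q0 q0t] : exists q0, q0 \in t.
  by case: (t) t0 => // q0 t' _; exists q0; rewrite mem_head.
have tP p : p \in t -> f p = g /\ p \in s.
  by rewrite mem_filter => /andP[/eqP].
have [fq0 q0s] := tP _ q0t; have [g0 gM _] := fP _ q0s; rewrite fq0 in g0 gM.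
have g0' : g%:Z != 0 by lia.
pose h (p : int * int) := ((p.1 %/ g)%Z, (p.2 %/ g)%Z).
have hK a b : h (a * g%:Z, b * g%:Z) = (a, b) by rewrite /h /= !mulzK.
have Mg0 : (0 < M %/ g ^ 2)%N by rewrite divn_gt0 ?expn_gt0 ?g0 // dvdn_leq.
rewrite -(size_map h); apply: (@leq_trans (tau (M %/ g ^ 2) * 10)%N); last first.
  by rewrite leq_mul // tau_dvd // dvdn_div.
apply: size_coprime_sumsq => //.
  rewrite map_inj_in_uniq ?filter_uniq // => p q /tP[fp ps] /tP[fq qs].
  have [_ _ [a [b [-> _ _]]]] := fP _ ps; have [_ _ [c [e [-> _ _]]]] := fP _ qs.
  by rewrite fp fq !hK => -[-> ->].
move=> _ /mapP[p /tP[fp ps] ->]; have [_ _ [a [b [pE cab eab]]]] := fP _ ps.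
by rewrite fp in pE eab; rewrite pE hK.
Qed.

(** * Mean values of gcd weights *)

(* The value at D = 0 is the trivial bound n, so that a bound on the mean of gcd_weight
   also bounds n times the probability that D = 0. *)
Definition gcd_weight (n r : nat) (D c : int) : nat :=
  if D == 0 then n else minn n ((n ^ r * gcdn `|D| `|c|) %/ `|D|)%N.

Lemma gcd_weight_le n r D c : (gcd_weight n r D c <= n)%N.
Proof. by rewrite /gcd_weight; case: eqP => // _; rewrite geq_minl. Qed.

Definition tau_le (B T : nat) := forall m, (0 < m <= B)%N -> (tau m <= T)%N.

(* The sum counts the pairs (i, j) with i j <= Y, that is, the divisors of all m <= Y. *)
Lemma sum_divn (Y B T : nat) : tau_le B T -> (Y <= B)%N ->
  (\sum_(1 <= j < Y.+1) Y %/ j <= Y * T)%N.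
Proof.
move=> tT YB; under eq_bigr do rewrite divn_count_dvd.
rewrite exchange_big_nat /=.
apply: (@leq_trans (\sum_(1 <= m < Y.+1) T)%N); last first.
  by rewrite sum_nat_const_nat subn1.
rewrite big_nat [X in (_ <= X)%N]big_nat; apply: leq_sum => m /andP[m0 mY].
apply: leq_trans (tT m _); last by rewrite m0 (leq_trans _ YB).
rewrite (_ : (\sum_(_ <- _ | _) _)%N = count (dvdn^~ m) (index_iota 1 Y.+1)); last first.
  by rewrite -sum1_count [RHS]big_mkcond; apply: eq_bigr => j _; case: dvdn.
rewrite -size_filter; apply: uniq_leq_size.
  by rewrite filter_uniq // iota_uniq.
by move=> j; rewrite mem_filter -dvdn_divisors // => /andP[].
Qed.

(** Members of one residue class modulo M have distinct quotients by M. At most one quotient is 0,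
    contributing at most n; a quotient j > 0 contributes at most (X / M) / j, and [sum_divn] sums
    these. *)
Lemma sum_minn_ap (n X M B T : nat) (s : seq nat) : tau_le B T -> (X <= B)%N -> (0 < M)%N ->
  uniq s -> (forall k, k \in s -> (0 < k)%N) -> {in s &, forall k l, k = l %[mod M]} ->
  (\sum_(k <- s) minn n (X %/ k) <= n + X %/ M * T)%N.
Proof.
move=> tT XB M0 us s0 sM.
pose Y := (X %/ M)%N; pose g j := if j is 0 then n else (Y %/ j)%N.
apply: (@leq_trans (\sum_(k <- s) g (k %/ M)%N)).
  rewrite big_seq [X in (_ <= X)%N]big_seq; apply: leq_sum => k ks.
  rewrite /g; case E: (k %/ M)%N => [|j]; first exact: geq_minl.
  rewrite (leq_trans (geq_minr _ _)) // /Y -divnMA -E leq_div2l ?muln_gt0 ?M0 ?E //.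
  by rewrite -E mulnC leq_divM.
rewrite -(big_map (fun k => k %/ M)%N xpredT g); set js := map _ _.
have ujs : uniq js.
  rewrite map_inj_in_uniq // => k l ks ls e.
  by rewrite (divn_eq k M) (divn_eq l M) e (sM _ _ ks ls).
apply: (@leq_trans (\sum_(0 <= j < Y.+1) g j)%N); last first.
  rewrite big_nat_recl //= leq_add2l.
  have YB : (Y <= B)%N by apply: leq_trans (leq_div _ _) XB.
  by have := sum_divn tT YB; rewrite big_add1.
rewrite (bigID (fun j => j < Y.+1)%N) /= [X in (_ + X)%N]big1 ?addn0; last first.
  by move=> [//|j]; rewrite -leqNgt /= => h; rewrite divn_small.
rewrite -big_filter. apply: (uniq_sub_le_big leqnn (fun x y => leq_addr y x)).
- by rewrite filter_uniq.
- exact: iota_uniq.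
by move=> j; rewrite mem_filter mem_index_iota => /andP[].
Qed.

Lemma sum_minn_apz (n X M B T : nat) (s : seq int) : tau_le B T -> (X <= B)%N -> (0 < M)%N ->
  uniq s -> (forall k, k \in s -> k != 0) -> {in s &, forall k l, (M%:Z %| k - l)%Z} ->
  (\sum_(k <- s) minn n (X %/ `|k|) <= 2 * (n + X %/ M * T))%N.
Proof.
move=> tT XB M0 us s0 sM.
have abs_ap (P : pred int) : (forall k l, P k -> P l -> `|k|%N = `|l|%N -> k = l) ->
    (forall k l, P k -> P l -> (M%:Z %| k - l)%Z -> `|k| = `|l| %[mod M]) ->
    (\sum_(k <- s | P k) minn n (X %/ `|k|) <= n + X %/ M * T)%N.
  move=> injP modP; rewrite -big_filter -(big_map absz xpredT (fun k => minn n (X %/ k))).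
  apply: (sum_minn_ap n tT XB M0).
  - rewrite map_inj_in_uniq ?filter_uniq // => k l; rewrite !mem_filter.
    by move=> /andP[kP _] /andP[lP _]; apply: injP.
  - by move=> _ /mapP[k + ->]; rewrite mem_filter absz_gt0 => /andP[_ /s0].
  move=> _ _ /mapP[k + ->] /mapP[l + ->]; rewrite !mem_filter.
  move=> /andP[kP ks] /andP[lP ls].
  exact: modP (sM _ _ ks ls).
rewrite (bigID (fun k : int => 0 <= k)) /= mul2n -addnn leq_add //; apply: abs_ap.
- by move=> k l; lia.
- move=> k l k0 l0; rewrite -{1}(gez0_abs k0) -{1}(gez0_abs l0).
  by rewrite -eqz_mod_dvd !modz_nat => /eqP[].
- by move=> k l; lia.
move=> k l k0 l0; have -> : k - l = `|l|%N%:Z - `|k|%N%:Z by lia.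
by rewrite -eqz_mod_dvd !modz_nat => /eqP[->].
Qed.

Lemma leq_sum_fibers (I : finType) (T : eqType) (P : pred I) (f : I -> T)
    (s : seq T) (F : I -> nat) (K : nat) :
  (forall i, P i -> f i \in s) ->
  (forall u, u \in s -> (\sum_(i | P i && (f i == u)) F i <= K)%N) ->
  (\sum_(i | P i) F i <= size s * K)%N.
Proof.
elim: s P => [|u s IH] P fs Ks.
  by rewrite big_pred0 // => i; apply/negP => /fs.
rewrite (bigID (fun i => f i == u)) /= mulSn leq_add ?Ks ?mem_head //.
apply: IH => [i /andP[/fs]|v vs]; first by rewrite inE => /orP[->|].
apply: leq_trans (Ks v _); last by rewrite inE vs orbT.
rewrite (eq_bigl (fun i => (P i && (f i == v)) && (f i != u))); last first.
  by move=> i /=; rewrite andbAC.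
by rewrite [X in (_ <= X)%N](bigID (fun i => f i == u)) /= leq_addl.
Qed.

(* Group the t by the value g of the gcd, a divisor of c: within a group the integers
   (a t + b) / g are distinct and congruent modulo |a| / gcd(a, g), where gcd(a, g) | b. *)
Lemma gcd_weight_step (n r B T : nat) (a b c : int) :
  tau_le B T -> (0 < T)%N -> (n ^ r.+1 <= B)%N -> a != 0 -> c != 0 -> (`|c| <= B)%N ->
  (\sum_(t < n) gcd_weight n r.+1 (a * t%:Z + b) c
     <= n * (5 * T ^ 2 * (1 + gcd_weight n r a b)))%N.
Proof.
move=> tT T0 nB a0 c0 cB.
pose V := ((n ^ r * gcdn `|a| `|b|) %/ `|a|)%N.
have triv : (\sum_(t < n) gcd_weight n r.+1 (a * t%:Z + b) c <= n * n)%N.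
  rewrite -[X in (_ <= X * _)%N]card_ord -sum_nat_const leq_sum // => t _.
  exact: gcd_weight_le.
have T2 : (0 < 5 * T ^ 2)%N by rewrite muln_gt0 expn_gt0 T0.
have [nV|Vn] := leqP n V.
  apply: leq_trans triv _; rewrite leq_mul2l /gcd_weight (negbTE a0).
  by rewrite (minn_idPl nV) (leq_trans (leq_addl 1 n)) ?leq_pmull ?orbT.
have -> : gcd_weight n r a b = V.
  by rewrite /gcd_weight (negbTE a0); apply/minn_idPr/ltnW.
pose D (t : 'I_n) := a * t%:Z + b.
pose F t := gcd_weight n r.+1 (D t) c.
have injD : injective D by move=> t t' /addIr/(mulfI a0)[] /val_inj.
rewrite -/(\sum_(t < n) F t)%N (bigID (fun t => D t == 0)) /=.
have H0 : (\sum_(t < n | D t == 0) F t <= n)%N.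
  have [t0 Dt0|none] := pickP (fun t => D t == 0); last by rewrite big_pred0.
  rewrite (big_pred1 t0) ?gcd_weight_le // => t /=.
  apply/eqP/eqP => [e|->]; last exact/eqP.
  by apply: injD; rewrite e (eqP Dt0).
have H1 (q : nat) : (q \in divisors `|c|)%N ->
    (\sum_(t < n | (D t != 0) && (gcdn `|D t| `|c| == q)) F t
       <= 2 * (n + n * (1 + V) * T))%N.
  move=> qc; pose P t := (D t != 0) && (gcdn `|D t| `|c| == q)%N; rewrite -/(P _).
  rewrite (eq_bigl P) //.
  have [t0 Pt0|none] := pickP P; last by rewrite big_pred0.
  have /andP[Dt0 /eqP qE] := Pt0.
  have q0 : (0 < q)%N by rewrite -qE gcdn_gt0 !absz_gt0 Dt0.
  have PD t : P t -> (q %| D t)%Z by case/andP => _ /eqP <-; exact: dvdn_gcdl.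
  pose g := gcdn `|a| q; pose M := (`|a| %/ g)%N.
  have g0 : (0 < g)%N by rewrite gcdn_gt0 q0 orbT.
  have M0 : (0 < M)%N by rewrite divn_gt0 // dvdn_leq ?absz_gt0 // dvdn_gcdl.
  (* q divides some value a t0 + b, so gcd(a, q) divides b as well as a. *)
  have gV : (g <= gcdn `|a| `|b|)%N.
    rewrite dvdn_leq ?gcdn_gt0 ?absz_gt0 ?a0 // dvdn_gcd dvdn_gcdl /=.
    have -> : b = D t0 - a * t0%:Z by rewrite /D addrC addKr.
    rewrite -[(_ %| _)%N]/(g%:Z %| _)%Z rpredB //.
      by apply: dvdz_trans (PD _ Pt0); exact: dvdn_gcdr.
    by rewrite dvdz_mulr //; exact: dvdn_gcdl.
  have XM : (n ^ r.+1 %/ M <= n * (1 + V))%N.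
    have nrV : (n ^ r %/ M <= V)%N.
      by rewrite -(divnMr g0) divnK ?dvdn_gcdl // leq_div2r // leq_mul2l gV orbT.
    apply: leq_trans (_ : (n * (1 + n ^ r %/ M)) * M %/ M <= _)%N.
      by rewrite leq_div2r // expnS -mulnA leq_mul2l add1n (ltnW (ltn_ceil _ _)) ?orbT.
    by rewrite mulnK // leq_mul2l leq_add2l nrV orbT.
  have DK t : P t -> (D t %/ q)%Z * q%:Z = D t by move/PD; exact: divzK.
  pose ks := [seq (D t %/ q)%Z | t <- enum P].
  have -> : (\sum_(t < n | P t) F t = \sum_(k <- ks) minn n (n ^ r.+1 %/ `|k|))%N.
    rewrite big_map big_enum /=; apply: eq_bigr => t Pt.
    have /andP[Dt /eqP qt] := Pt.
    rewrite /F /gcd_weight (negbTE Dt) qt -{1}(DK _ Pt) abszM absz_nat.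
    by rewrite divnMr.
  apply: leq_trans (sum_minn_apz n tT nB M0 _ _ _) _.
  - rewrite map_inj_in_uniq ?enum_uniq // => t t'; rewrite !mem_enum => Pt Pt' e.
    by apply: injD; rewrite -(DK _ Pt) e DK.
  - move=> _ /mapP[t + ->]; rewrite mem_enum => Pt; have /andP[Dt _] := Pt.
    by apply: contraNneq Dt => e; rewrite -(DK _ Pt) e mul0r.
  - move=> _ _ /mapP[t + ->] /mapP[t' + ->]; rewrite !mem_enum => Pt Pt'.
    have ag : (g %| a)%Z by exact: dvdn_gcdl.
    have qg : (g %| q)%N by exact: dvdn_gcdr.
    have cop : coprimez M%:Z (q %/ g)%N%:Z.
      rewrite /coprimez /gcdz /= eqz_nat -(eqn_pmul2r g0) muln_gcdl !divnK ?mul1n //.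
    rewrite -(Gauss_dvdzl _ cop).
    have g0' : g%:Z != 0 by rewrite -lt0n.
    rewrite -(dvdz_mul2r g0') -mulrA -PoszM divnK // mulrBl !DK //.
    have -> : D t - D t' = a * (t%:Z - t'%:Z) by rewrite /D; ring.
    rewrite dvdz_mulr // -PoszM divnK ?dvdn_gcdl //.
    by rewrite [X in is_true X]dvdnn.
  by rewrite leq_mul2l leq_add2l leq_mul2r XM !orbT.
have cT : (size (divisors `|c|) <= T)%N by apply: tT; rewrite absz_gt0 c0.
apply: leq_trans (leq_add H0 (_ : _ <= T * (2 * (n + n * (1 + V) * T)))%N) _.
  apply: leq_trans (leq_sum_fibers _ H1) _.
    by move=> t Dt; rewrite -dvdn_divisors ?absz_gt0 // dvdn_gcdr.
  by rewrite leq_mul2r cT orbT.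
have -> : (T * (2 * (n + n * (1 + V) * T)) = n * (2 * T + 2 * T ^ 2 * (1 + V)))%N.
  by rewrite expnS expn1; ring.
rewrite -[X in (X + _)%N]muln1 -mulnDr leq_mul2l; apply/orP; right.
have : (T <= T ^ 2)%N by rewrite expnS expn1 leq_pmull.
by nia.
Qed.

Lemma card_residue_class n M (P : pred 'I_n) : (0 < M)%N ->
  (forall t t', P t -> P t' -> t = t' %[mod M]) -> (#|P| <= (n %/ M).+1)%N.
Proof.
move=> M0 PM; rewrite -[X in (_ <= X)%N]card_ord.
pose f (t : 'I_n) : 'I_(n %/ M).+1 := inord (t %/ M).
have fE t : f t = (t %/ M)%N :> nat by rewrite inordK // ltnS leq_div2r // ltnW.
apply: (leq_card_in f) => t t' Pt Pt' /(congr1 val); rewrite /= !fE => e.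
by apply: val_inj => /=; rewrite (divn_eq t M) (divn_eq t' M) e (PM _ _ Pt Pt').
Qed.

(* Group the t by the value h of the gcd, a divisor of a: the t with h | b t + c lie in one
   residue class modulo h / gcd(h, b). *)
Lemma gcd_weight_avg (n r B T : nat) (a b c : int) :
  tau_le B T -> (0 < T)%N -> (`|a| <= B)%N -> 
  (\sum_(t < n) gcd_weight n r a (b * t%:Z + c)
     <= n * (5 * T ^ 2 * (1 + gcd_weight n r a b)))%N.
Proof.
move=> tT T0 aB.
have T2 : (0 < 5 * T ^ 2)%N by rewrite muln_gt0 expn_gt0 T0.
have triv : (\sum_(t < n) gcd_weight n r a (b * t%:Z + c) <= n * n)%N.
  rewrite -[X in (_ <= X * _)%N]card_ord -sum_nat_const leq_sum // => t _.
  exact: gcd_weight_le.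
have trivn : gcd_weight n r a b = n ->
    (\sum_(t < n) gcd_weight n r a (b * t%:Z + c)
     <= n * (5 * T ^ 2 * (1 + gcd_weight n r a b)))%N.
  move=> ->; apply: leq_trans triv _.
  by rewrite leq_mul2l (leq_trans (leq_addl 1 n)) ?leq_pmull ?orbT.
have [a0|a0] := eqVneq a 0; first by apply: trivn; rewrite /gcd_weight a0 eqxx.
pose V := ((n ^ r * gcdn `|a| `|b|) %/ `|a|)%N.
have wE c' : gcd_weight n r a c' = minn n (n ^ r * gcdn `|a| `|c'| %/ `|a|).
  by rewrite /gcd_weight (negbTE a0).
have [nV|Vn] := leqP n V; first by apply: trivn; rewrite wE; apply/minn_idPl.
have -> : gcd_weight n r a b = V by rewrite wE; apply/minn_idPr/ltnW.
pose D (t : 'I_n) := b * t%:Z + c.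
have H (h : nat) : (h \in divisors `|a|)%N ->
    (\sum_(t < n | gcdn `|a| `|D t| == h) gcd_weight n r a (D t) <= n * (2 + V))%N.
  rewrite -dvdn_divisors ?absz_gt0 // => ha.
  have h0 : (0 < h)%N by rewrite (dvdn_gt0 _ ha) ?absz_gt0.
  set W := (n ^ r * h %/ `|a|)%N.
  pose P t := gcdn `|a| `|D t| == h.
  apply: (@leq_trans (#|P| * minn n W)).
    rewrite -sum_nat_const; apply/eq_leq/eq_bigr => t /eqP Pt.
    by rewrite wE Pt.
  pose M := (h %/ gcdn h `|b|)%N.
  have g0 : (0 < gcdn h `|b|)%N by rewrite gcdn_gt0 h0.
  have M0 : (0 < M)%N by rewrite divn_gt0 // dvdn_leq // dvdn_gcdl.
  have cP : (#|P| <= (n %/ M).+1)%N.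
    apply: card_residue_class M0 _ => t t' Pt Pt'.
    have hD t1 : P t1 -> (h %| D t1)%Z by move/eqP => <-; exact: dvdn_gcdr.
    suff : (M %| t%:Z - t'%:Z)%Z by rewrite -eqz_mod_dvd !modz_nat => /eqP[].
    have /dvdzP[b' bE] : (gcdn h `|b| %| b)%Z by exact: dvdn_gcdr.
    set g := gcdn h `|b| in g0 bE *.
    have cop : coprimez M%:Z b'.
      rewrite /coprimez /gcdz /= eqz_nat -(eqn_pmul2r g0) muln_gcdl.
      by rewrite divnK ?dvdn_gcdl // -[X in gcdn _ (_ * X)]absz_nat -abszM -bE mul1n.
    have g0' : g%:Z != 0 by rewrite -lt0n.
    rewrite -(Gauss_dvdzl _ cop) -(dvdz_mul2r g0') -mulrA -bE -PoszM.
    rewrite divnK ?dvdn_gcdl //.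
    have -> : (t%:Z - t'%:Z) * b = D t - D t' by rewrite /D; ring.
    by rewrite rpredB // hD.
  (* The rounding term 1 costs at most n. The main term is (n / M) W, and h = M gcd(h, b) with
     gcd(h, b) dividing gcd(a, b) turns it into at most n (1 + V). *)
  apply: (@leq_trans ((n %/ M).+1 * minn n W)); first by rewrite leq_mul2r cP orbT.
  rewrite mulSn (_ : 2 + V = 1 + (1 + V))%N // mulnDr muln1 leq_add ?geq_minl //.
  apply: (@leq_trans (n %/ M * W)); first by rewrite leq_mul2l geq_minr orbT.
  have A0 : (0 < `|a|)%N by rewrite absz_gt0.
  rewrite -(leq_pmul2r A0) -mulnA.
  apply: (@leq_trans (n %/ M * (n ^ r * h))); first by rewrite leq_mul2l leq_divM orbT.
  have -> : (n %/ M * (n ^ r * h) = (n %/ M * M) * (n ^ r * gcdn h `|b|))%N.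
    by rewrite -{1}(divnK (dvdn_gcdl h `|b|)); ring.
  rewrite -[X in (_ <= X)%N]mulnA leq_mul ?leq_divM //.
  apply: (@leq_trans (n ^ r * gcdn `|a| `|b|)%N).
    by rewrite leq_mul2l dvdn_leq ?orbT ?gcdn_gt0 ?A0 // dvdn_gcd dvdn_gcdr
      (dvdn_trans (dvdn_gcdl _ _) ha).
  by rewrite add1n ltnW // ltn_ceil.
apply: leq_trans (leq_sum_fibers (P := xpredT) (f := fun t => gcdn `|a| `|D t|)
  (F := fun t => gcd_weight n r a (D t)) _ H) _.
  by move=> t _; rewrite -dvdn_divisors ?absz_gt0 // dvdn_gcdl.
have aT : (size (divisors `|a|) <= T)%N by apply: tT; rewrite absz_gt0 a0.
apply: leq_trans (_ : T * (n * (2 + V)) <= _)%N; first by rewrite leq_mul2r aT orbT.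
rewrite mulnCA leq_mul2l; apply/orP; right.
have : (T <= T ^ 2)%N by rewrite expnS expn1 leq_pmull.
by nia.
Qed.

(** * Averaging over the entries of a random configuration *)

(* put and get behave like a lens: every Y is put X t for exactly #|K| pairs (X, t). *)
Lemma sum_put (Om K : finType) (get : Om -> K) (put : Om -> K -> Om) (F : Om -> nat) :
  (forall X t s, put (put X t) s = put X s) -> (forall X, put X (get X) = X) ->
  (forall X t, get (put X t) = t) ->
  (\sum_X \sum_t F (put X t) = #|K| * \sum_X F X)%N.
Proof.
move=> pp pg gp; rewrite pair_big /=.
pose h (p : Om * K) := (put p.1 p.2, get p.1).
have hK : involutive h by move=> [X t]; rewrite /h /= pp pg gp.
rewrite (reindex h) /=; last by exists h => ? _; apply: hK.
under eq_bigr do rewrite pp pg.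
rewrite -(pair_bigA _ (fun X t => F X)) /=.
by under eq_bigr do rewrite sum_nat_const; rewrite -big_distrr.
Qed.

(* A config is a tuple of points of the lattice cube, indexed by I, up to the common shift
   by (1, ..., 1); o denotes the index of the base point x_0. *)
Definition config (I J : finType) (n : nat) := {ffun I -> {ffun J -> 'I_n}}.

Definition put_point (I J : finType) n (i : I) (X : config I J n) (p : {ffun J -> 'I_n}) :
  config I J n := [ffun k => if k == i then p else X k].

Definition put_entry (I J : finType) n (i : I) (j : J) (X : config I J n) (t : 'I_n) :
  config I J n := put_point i X [ffun l => if l == j then t else X i l].

(** Resampling the point [i] does not change the mean of [F]. The factor [n ^ #|J|] is there because
    the inner sum over the new point is not normalised. *)
Lemma sum_put_point (I J : finType) n (i : I) (F G : config I J n -> nat) :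
  (forall X, \sum_p F (put_point i X p) <= G X)%N ->
  (n ^ #|J| * \sum_X F X <= \sum_X G X)%N.
Proof.
move=> FG; rewrite -[X in (X ^ _)%N]card_ord -card_ffun.
rewrite -(sum_put (get := fun X : config I J n => X i) (put := put_point i)); last first.
- by move=> X p; rewrite ffunE eqxx.
- by move=> X; apply/ffunP => k; rewrite ffunE; case: eqP => [->|].
- by move=> X p q; apply/ffunP => k; rewrite !ffunE; case: eqP.
by apply: leq_sum => X _; apply: FG.
Qed.

Lemma sum_put_entry (I J : finType) n (i : I) (j : J) (F G : config I J n -> nat) :
  (0 < n)%N -> 
  (forall X, \sum_t F (put_entry i j X t) <= n * G X)%N ->
  (\sum_X F X <= \sum_X G X)%N.
Proof.
move=> n0 FG; rewrite -(leq_pmul2l n0) -[X in (X * _ <= _)%N]card_ord.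
rewrite -(sum_put (get := fun X : config I J n => X i j) (put := put_entry i j)); last first.
- by move=> X t; rewrite !ffunE eqxx ffunE eqxx.
- move=> X; apply/ffunP => k; apply/ffunP => l; rewrite !ffunE; case: eqP => // ->.
  by rewrite ffunE; case: eqP => // ->.
- move=> X t s; apply/ffunP => k; apply/ffunP => l; rewrite !ffunE; case: eqP => // _.
  by rewrite !ffunE eqxx !ffunE; case: eqP.
by rewrite big_distrr /=; apply: leq_sum => X _; apply: FG.
Qed.

Definition dif (I J : finType) n (o : I) (X : config I J n) (i : I) (j : J) : int :=
  (X i j)%:Z - (X o j)%:Z.

Definition dif_mx (I J : finType) n (o : I) r (rho : 'I_r -> I) s (kap : 'I_s -> J)
  (X : config I J n) : 'M[int]_(r, s) := \matrix_(i, j) dif o X (rho i) (kap j).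

Lemma dif_put (I J : finType) n (o i : I) (j : J) (X : config I J n) t k l : i != o ->
  dif o (put_entry i j X t) k l =
    if (k == i) && (l == j) then t%:Z - (X o j)%:Z else dif o X k l.
Proof.
move=> io; rewrite /dif !ffunE [o == i]eq_sym (negbTE io).
by case: (k =P i) => // ->; rewrite !ffunE; case: eqP => // ->.
Qed.

Lemma dif_put_point (I J : finType) n (o i : I) (X : config I J n) p k l : i != o ->
  dif o (put_point i X p) k l =
    if k == i then (p l)%:Z - (X o l)%:Z else dif o X k l.
Proof.
move=> io; rewrite /dif !ffunE [o == i]eq_sym (negbTE io).
by case: (k =P i).
Qed.

Lemma dif_le (I J : finType) n (o : I) (X : config I J n) i j : (`|dif o X i j| <= n)%N.
Proof. by rewrite /dif; have := ltn_ord (X i j); have := ltn_ord (X o j); lia. Qed.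

Lemma det_le r (A : 'M[int]_r) (b : nat) : (forall i j, `|A i j| <= b)%N ->
  (`|\det A| <= r`! * b ^ r)%N.
Proof.
move=> Ab; rewrite -lez_nat abszE PoszM.
rewrite /determinant; apply: le_trans (ler_norm_sum _ _ _) _.
apply: (@le_trans _ _ (\sum_(s : 'S_r) (b ^ r)%N%:Z)).
  apply: ler_sum => s _; rewrite normrM normrX normrN1 expr1n mul1r normr_prod.
  apply: le_trans (_ : \prod_(i < r) b%:Z <= _).
    by apply: ler_prod => i _; rewrite normr_ge0 /= -abszE lez_nat.
  by rewrite prodr_const card_ord -!natz natrX.
by rewrite sumr_const card_Sn -mulr_natl natz.
Qed.

Lemma eq_gcd_weight n r D D' c c' : `|D|%N = `|D'|%N -> `|c|%N = `|c'|%N ->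
  gcd_weight n r D c = gcd_weight n r D' c'.
Proof. by rewrite /gcd_weight -!absz_eq0 => -> ->. Qed.

Definition minor (I J : finType) n (o : I) r (rho : 'I_r -> I) (kap : 'I_r -> J)
  (X : config I J n) : int := \det (dif_mx o rho kap X).

Definition last_cof (I J : finType) n (o : I) r (rho : 'I_r.+1 -> I) (kap : 'I_r.+1 -> J)
  (j : 'I_r.+1) (X : config I J n) : int := cofactor (dif_mx o rho kap X) ord_max j.

Lemma abs_last_cof (I J : finType) n (o : I) r (rho : 'I_r.+1 -> I) (kap : 'I_r.+1 -> J)
    (j : 'I_r.+1) (X : config I J n) :
  `|last_cof o rho kap j X|%N =
    `|minor o (rho \o lift ord_max) (kap \o lift j) X|%N.
Proof.
rewrite /last_cof /cofactor abszMsign; congr (`|\det _|%N).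
by apply/matrixP => a b; rewrite !mxE.
Qed.

Lemma eq_minor (I J : finType) n (o : I) r (rho : 'I_r -> I) (kap : 'I_r -> J)
    (X Y : config I J n) :
  (forall i j, dif o X (rho i) (kap j) = dif o Y (rho i) (kap j)) ->
  minor o rho kap X = minor o rho kap Y.
Proof. by move=> e; congr (\det _); apply/matrixP => i j; rewrite !mxE. Qed.

Lemma eq_last_cof (I J : finType) n (o : I) r (rho : 'I_r.+1 -> I) (kap : 'I_r.+1 -> J)
    (j : 'I_r.+1) (X Y : config I J n) :
  (forall i l, i != ord_max -> l != j ->
    dif o X (rho i) (kap l) = dif o Y (rho i) (kap l)) ->
  last_cof o rho kap j X = last_cof o rho kap j Y.
Proof.
move=> e; rewrite /last_cof /cofactor; congr (_ * \det _).
by apply/matrixP => a b; rewrite !mxE e // eq_sym neq_lift.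
Qed.

Lemma minor_le (I J : finType) n (o : I) r (rho : 'I_r -> I) (kap : 'I_r -> J)
    (X : config I J n) : (`|minor o rho kap X| <= r`! * n ^ r)%N.
Proof. by apply: det_le => i j; rewrite mxE dif_le. Qed.

Lemma minor_expand (I J : finType) n (o : I) r (rho : 'I_r.+1 -> I) (kap : 'I_r.+1 -> J)
    (X : config I J n) :
  minor o rho kap X = \sum_j dif o X (rho ord_max) (kap j) * last_cof o rho kap j X.
Proof.
by rewrite /minor (expand_det_row _ ord_max); apply: eq_bigr => j _; rewrite mxE.
Qed.

Definition rest_expand (I J : finType) n (o : I) r (rho : 'I_r.+1 -> I)
    (kap : 'I_r.+1 -> J) (k : 'I_r.+1) (X : config I J n) : int :=
  \sum_(j | j != k) dif o X (rho ord_max) (kap j) * last_cof o rho kap j X.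

Lemma last_cof_put (I J : finType) n (o : I) r (rho : 'I_r.+1 -> I) (kap : 'I_r.+1 -> J)
    (j : 'I_r.+1) l (X : config I J n) t : injective rho -> (forall i, rho i != o) ->
  last_cof o rho kap j (put_entry (rho ord_max) l X t) = last_cof o rho kap j X.
Proof.
move=> ir ro; apply: eq_last_cof => i l' im _.
by rewrite dif_put // (inj_eq ir) (negbTE im).
Qed.

Lemma rest_expand_put (I J : finType) n (o : I) r (rho : 'I_r.+1 -> I) (kap : 'I_r.+1 -> J)
    (k : 'I_r.+1) (X : config I J n) t :
  injective rho -> injective kap -> (forall i, rho i != o) ->
  rest_expand o rho kap k (put_entry (rho ord_max) (kap k) X t) = rest_expand o rho kap k X.
Proof.
move=> ir ik ro; apply: eq_bigr => j jk; rewrite last_cof_put // dif_put //.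
by rewrite (inj_eq ik) (negbTE jk) andbF.
Qed.

(** This is D = N s + e: the cofactors of the last row ignore that row, so the minor is affine in
    each of its entries. The subtracted term appears because the resampled quantity is a coordinate
    and not a difference. *)
Lemma minor_put (I J : finType) n (o : I) r (rho : 'I_r.+1 -> I) (kap : 'I_r.+1 -> J)
    (k : 'I_r.+1) (X : config I J n) t :
  injective rho -> injective kap -> (forall i, rho i != o) ->
  minor o rho kap (put_entry (rho ord_max) (kap k) X t) =
    last_cof o rho kap k X * t%:Z +
    (rest_expand o rho kap k X - last_cof o rho kap k X * (X o (kap k))%:Z).
Proof.
move=> ir ik ro; rewrite minor_expand (bigD1 k) //= -/(rest_expand _ _ _ _ _).
by rewrite rest_expand_put // last_cof_put // dif_put // !eqxx /=; ring.
Qed.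

(* The last hypothesis says that c does not depend on the entry in the last row and first
   column of the minor, over which the first averaging takes place. *)
Definition one_weight_bound (I J : finType) n (o : I) (B r M : nat) :=
  forall (rho : 'I_r -> I) (kap : 'I_r -> J) (c : config I J n -> int),
    injective rho -> injective kap -> (forall i, rho i != o) ->
    (forall X, `|c X| <= B)%N ->
    (forall i j : 'I_r, i.+1 = r -> j = 0%N :> nat -> forall X t,
       c (put_entry (rho i) (kap j) X t) = c X) ->
  (\sum_(X : config I J n) (c X != 0%R) * gcd_weight n r (minor o rho kap X) (c X)
     <= M * #|{: config I J n}|)%N.

(** The minor omitting column 1 does not involve column 1, which is the first column of the minor
    omitting column 0; hence it may serve as [c] in [one_weight_bound]. Where it vanishes the weight
    is at most n, which is its own weight against 1; this second application gives the factor 2. *)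
Lemma two_weight_bound (I J : finType) n (o : I) (B r M : nat) (rho : 'I_r.+1 -> I)
    (kap : 'I_r.+2 -> J) : (0 < n)%N -> (r.+1`! * n ^ r.+1 <= B)%N ->
    one_weight_bound J n o B r.+1 M ->
    injective rho -> injective kap -> (forall i, rho i != o) ->
  (\sum_(X : config I J n) gcd_weight n r.+1 (minor o rho (kap \o lift ord0) X)
      (minor o rho (kap \o lift (lift ord0 ord0)) X)
     <= (2 * M) * #|{: config I J n}|)%N.
Proof.
move=> n0 nB bnd ir ik ro; set k1 := lift ord0 ord0.
pose a (X : config I J n) := minor o rho (kap \o lift ord0) X.
pose a' (X : config I J n) := minor o rho (kap \o lift k1) X.
have i0 : injective (kap \o lift ord0) by apply: inj_comp => //; exact: lift_inj.
have i1 : injective (kap \o lift k1) by apply: inj_comp => //; exact: lift_inj.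
have B1 (j : 'I_r.+2) (X : config I J n) : (`|minor o rho (kap \o lift j) X| <= B)%N.
  exact: leq_trans (minor_le _ _ _ _) nB.
apply: (@leq_trans (\sum_X ((a' X != 0%R) * gcd_weight n r.+1 (a X) (a' X) +
    (1%:Z != 0%R) * gcd_weight n r.+1 (a' X) 1))).
  apply: leq_sum => X _; rewrite -/(a X) -/(a' X) mul1n.
  have [->|_] := eqVneq (a' X) 0; last by rewrite mul1n leq_addr.
  by rewrite mul0n add0n {2}/gcd_weight eqxx gcd_weight_le.
rewrite big_split /= mul2n -addnn mulnDl leq_add //.
  apply: (bnd rho (kap \o lift ord0) a') => // [X|i j ir1 j0 X t]; first exact: B1.
  apply: eq_minor => k l.
  rewrite dif_put // /= (inj_eq ik) (_ : lift k1 l == _ = false) ?andbF //.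
  have -> : lift ord0 j = k1 by apply: val_inj; rewrite /= j0.
  by rewrite eq_sym; apply/negbTE/neq_lift.
apply: (bnd rho (kap \o lift k1) (fun=> 1)) => // X.
by apply: leq_trans nB; rewrite muln_gt0 fact_gt0 expn_gt0 n0.
Qed.

(** Induction on the order of the minor: [gcd_weight_step] over the first entry of the last row,
    [gcd_weight_avg] over the second, then [two_weight_bound] for the two cofactors of lower order.
    With G = 5 T^2 one round costs at most the factor 4 G^2 = 100 T^4. *)
Lemma weight_bound (I J : finType) n (o : I) (B T r : nat) : (0 < n)%N -> (0 < T)%N ->
  (forall k, k <= r -> k`! * n ^ k <= B)%N -> tau_le B T ->
  one_weight_bound J n o B r ((100 * T ^ 4) ^ r).
Proof.
move=> n0 T0 + tT; elim: r => [|r IH] nB rho kap c ir ik ro cB cput.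
  rewrite expn0 mul1n -sum1_card; apply: leq_sum => X _.
  rewrite /minor det_mx00 /gcd_weight oner_eq0 expn0 mul1n gcd1n divn1.
  by case: eqP => //= _; rewrite ?mul0n ?mul1n ?geq_minr.
pose G := (5 * T ^ 2)%N; pose m := #|{: config I J n}|.
have G0 : (0 < G)%N by rewrite muln_gt0 expn_gt0 T0.
have nB' : (n ^ r.+1 <= B)%N by apply: leq_trans (nB _ (leqnn _)); rewrite leq_pmull ?fact_gt0.
pose a := last_cof (n := n) o rho kap ord0.
pose b X := rest_expand o rho kap ord0 X - a X * (X o (kap ord0))%:Z.
have step1 : (\sum_X (c X != 0%R) * gcd_weight n r.+1 (minor o rho kap X) (c X)
    <= \sum_X G * (1 + gcd_weight n r (a X) (b X)))%N.
  apply: (@sum_put_entry _ _ _ (rho ord_max) (kap ord0)) => // X.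
  under eq_bigr => t _ do rewrite cput // minor_put // -/(a X) -/(b X).
  rewrite -big_distrr /=; have [_|c0] := eqVneq (c X) 0; first by rewrite mul0n.
  (* For a vanishing cofactor the weight of (a, b) is n by convention, so the trivial bound n on
     each summand is enough. *)
  rewrite mul1n; have [a0|a0] := eqVneq (a X) 0; last exact: (gcd_weight_step _ tT).
  rewrite a0 /gcd_weight eqxx (leq_trans (_ : _ <= n * n)%N) //.
    rewrite -[X in (_ <= X * _)%N]card_ord -sum_nat_const leq_sum // => t _.
    by rewrite -/(gcd_weight _ _ _ _) gcd_weight_le.
  by rewrite leq_mul2l (leq_trans (leq_addl 1 n)) ?leq_pmull ?orbT.
apply: leq_trans step1 _.
(* A minor of order 1 has no second column to average over; its cofactor is the empty determinant 1,
   of weight at most 1. *)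
case: r IH rho kap ir ik ro cput nB nB' @a @b => [|r] IH rho kap ir ik ro cput nB nB' a b.
  apply: (@leq_trans (\sum_(X : config I J n) G * 2)).
    apply: leq_sum => X _; rewrite leq_mul2l; apply/orP; right.
    have -> : a X = 1 by rewrite /a /last_cof /cofactor det_mx00 /= expr0 mul1r.
    rewrite /gcd_weight oner_eq0 expn0 mul1n gcd1n divn1.
    exact: (leq_add (leqnn 1) (geq_minr _ _)).
  rewrite sum_nat_const mulnC leq_mul2r; apply/orP; right.
  rewrite /G expn1; have : (T ^ 2 <= T ^ 4)%N by rewrite leq_pexp2l.
  by nia.
set k1 : 'I_r.+2 := lift ord0 ord0.
pose a' := last_cof (n := n) o rho kap k1.
have step2 : (\sum_X G * (1 + gcd_weight n r.+1 (a X) (b X))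
    <= \sum_X G * (1 + G * (1 + gcd_weight n r.+1 (a X) (a' X))))%N.
  apply: (@sum_put_entry _ _ _ (rho ord_max) (kap k1)) => // X.
  rewrite -big_distrr mulnCA leq_mul2l; apply/orP; right.
  rewrite big_split /= sum_nat_const card_ord muln1 mulnDr muln1 leq_add2l.
  pose e (Y : config I J n) := \sum_(j | (j != ord0) && (j != k1))
    dif o Y (rho ord_max) (kap j) * last_cof o rho kap j Y.
  pose f (Y : config I J n) := e Y - a' Y * (Y o (kap k1))%:Z - a Y * (Y o (kap ord0))%:Z.
  have ro' : rho ord_max != o by [].
  have aput t : a (put_entry (rho ord_max) (kap k1) X t) = a X by rewrite /a last_cof_put.
  have bput t : b (put_entry (rho ord_max) (kap k1) X t) = a' X * t%:Z + f X.
    rewrite /b aput /rest_expand (bigD1 k1) //= last_cof_put // dif_put // !eqxx /=.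
    rewrite !ffunE [o == _]eq_sym (negbTE ro') /f /e.
    rewrite (eq_bigr (fun j => dif o X (rho ord_max) (kap j) * last_cof o rho kap j X)).
      by rewrite /a'; ring.
    move=> j /andP[_ jk]; rewrite last_cof_put // dif_put //.
    by rewrite (inj_eq ik) (negbTE jk) andbF.
  have a'put t : a' (put_entry (rho ord_max) (kap k1) X t) = a' X by rewrite /a' last_cof_put.
  under eq_bigr => t _ do rewrite aput bput.
  apply: gcd_weight_avg tT T0 _.
  rewrite /a abs_last_cof; apply: leq_trans (minor_le _ _ _ _) _.
  exact: nB.
apply: leq_trans step2 _.
pose rho' := rho \o lift ord_max.
have ir' : injective rho' by apply: inj_comp => //; exact: lift_inj.
have bnd2 : (\sum_X gcd_weight n r.+1 (a X) (a' X) <= 2 * (100 * T ^ 4) ^ r.+1 * m)%N.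
  have nBr : (r.+1`! * n ^ r.+1 <= B)%N by apply: nB.
  have IH' := IH (fun k kr => nB k (leqW kr)).
  have := two_weight_bound n0 nBr IH' ir' ik (fun i => ro _).
  rewrite -/m; apply: leq_trans; apply/eq_leq/eq_bigr => X _.
  by apply: eq_gcd_weight; rewrite /a /a' abs_last_cof.
rewrite (eq_bigr (fun X => (G + G ^ 2) + G ^ 2 * gcd_weight n r.+1 (a X) (a' X))%N); last first.
  by move=> X _; ring.
rewrite big_split /= sum_nat_const -big_distrr /= -/m.
apply: leq_trans (leq_add (leqnn _) (leq_mul (leqnn _) bnd2)) _.
set L := ((100 * T ^ 4) ^ r.+1)%N.
have L0 : (0 < L)%N by rewrite expn_gt0 muln_gt0 expn_gt0 T0.
have GL : (G <= G ^ 2)%N by rewrite expnS expn1 leq_pmull.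
have -> : ((100 * T ^ 4) ^ r.+2 = 4 * G ^ 2 * L)%N.
  by rewrite expnS -/L /G; ring.
have G2L : (G ^ 2 <= G ^ 2 * L)%N by rewrite leq_pmulr.
have -> : (4 * G ^ 2 * L * m = m * (2 * (G ^ 2 * L)) + G ^ 2 * (2 * L * m))%N by ring.
by rewrite leq_add2r leq_mul2l; apply/orP; right; lia.
Qed.

(** * Points of the box on a sphere or on a hyperplane *)

Lemma leq_card_fibers (S U : finType) (P : pred S) (f : S -> U) (K : nat) :
  (forall u, #|[pred y | P y && (f y == u)]| <= K)%N -> (#|P| <= #|U| * K)%N.
Proof.
move=> PK; rewrite -sum1_card cardT.
apply: (leq_sum_fibers (f := f)) => [y _|u _]; first by rewrite mem_enum.
by rewrite sum1_card; apply: PK.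
Qed.

Definition shift_dot (d n : nat) (p : {ffun 'I_d -> 'I_n}) (w : 'I_d -> int)
    (y : {ffun 'I_d -> 'I_n}) : int :=
  \sum_j ((y j)%:Z - (p j)%:Z) * w j.

(* The vectors f k are k e_0 reduced modulo the rows of Z, for 0 <= k < D / gcd(D, w_0);
   they lie in distinct classes modulo the lattice D | z.w, so the translates of the
   lattice points by the f k are pairwise distinct. *)
Lemma card_lattice (d n : nat) (p : {ffun 'I_d.+1 -> 'I_n}) (Z : 'M[int]_d.+1)
    (w : 'cV[int]_d.+1) (L : pred {ffun 'I_d.+1 -> 'I_n}) :
  \det Z != 0 -> (forall i j, `|Z i j| <= n)%N ->
  (forall i, (\det Z %| (Z *m w) i 0%R)%Z) ->
  (forall y, L y -> (\det Z %| shift_dot p (fun j => w j 0%R) y)%Z) ->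
  (#|L| * (`|\det Z| %/ gcdn `|\det Z| `|w 0%R 0%R|) <= (2 * d.+2 * n).+1 ^ d.+1)%N.
Proof.
set D := \det Z => D0 Zn Zw Lw.
set g := gcdn _ _; set q := (_ %/ _)%N.
pose u k : 'rV[int]_d.+1 := \row_i ((k%:Z * (\adj Z) ord0 i) %/ D)%Z.
pose f k : 'rV[int]_d.+1 := k%:Z *: delta_mx 0 0 - u k *m Z.
(* D e_0 is row 0 of [\adj Z] times Z, so D f_k combines the rows of Z with coefficients reduced
   modulo D. This bounds the entries of f_k independently of k. *)
have Df k : D *: f k = (\row_i ((k%:Z * (\adj Z) ord0 i) %% D)%Z) *m Z.
  have -> : (\row_i ((k%:Z * (\adj Z) ord0 i) %% D)%Z) = k%:Z *: row 0 (\adj Z) - D *: u k.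
    by apply/rowP => i; rewrite !mxE [D * _]mulrC.
  rewrite mulmxBl -!scalemxAl -row_mul mul_adj_mx /f scalerBr; congr (_ - _).
  rewrite scalerA mulrC -scalerA; congr (_ *: _).
  by apply/rowP => i; rewrite !mxE eqxx /= eq_sym mulr_natr.
have f_le k j : `|f k 0 j| <= (d.+1 * n)%N%:Z.
  have D0' : 0 < `|D| by rewrite normr_gt0.
  rewrite -(ler_pM2l D0') -normrM.
  have -> : D * f k 0 j = (D *: f k) 0 j by rewrite [RHS]mxE.
  rewrite Df mxE; apply: le_trans (ler_norm_sum _ _ _) _.
  apply: (@le_trans _ _ (\sum_(i < d.+1) `|D| * n%:Z)).
    apply: ler_sum => i _; rewrite normrM mxE ler_pM //.
      by rewrite ger0_norm ?modz_ge0 // ltW // ltz_mod.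
    by rewrite -abszE lez_nat Zn.
  by rewrite sumr_const card_ord -mulr_natl PoszM natz mulrCA.
have fw k : (D %| (\sum_j f k 0 j * w j 0 - k%:Z * w 0 0)%R)%Z.
  have -> : \sum_j f k 0 j * w j 0 = (f k *m w) 0 0 by rewrite mxE.
  rewrite /f mulmxBl -scalemxAl -mulmxA -rowE !mxE.
  rewrite addrAC subrr add0r rpredN rpred_sum // => i _.
  by rewrite dvdz_mull.
(* The entries of y - p are below n and those of f_k at most (d+1) n in absolute value; the shift by
   (d+2) n makes the sums natural numbers up to 2 (d+2) n. *)
pose phi (x : {ffun 'I_d.+1 -> 'I_n} * 'I_q) : {ffun 'I_d.+1 -> 'I_(2 * d.+2 * n).+1} :=
  [ffun j => inord `|((x.1 j)%:Z - (p j)%:Z + f x.2 0 j + (d.+2 * n)%N%:Z)%R|].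
have phiE x j : (phi x j : nat)%:Z =
    (x.1 j)%:Z - (p j)%:Z + f x.2 0 j + (d.+2 * n)%N%:Z.
  have := ltn_ord (x.1 j); have := ltn_ord (p j); have := f_le x.2 j.
  rewrite ffunE; move: (f _ _ _) (x.1 j : nat) (p j : nat) => a b c.
  rewrite ler_norml !PoszM => /andP[a1 a2] h2 h3.
  have e : (d.+2%:Z * n%:Z) = d.+1%:Z * n%:Z + n%:Z by rewrite -addn1 PoszD mulrDl mul1r.
  rewrite e in a1 a2 *; rewrite inordK; last by rewrite mulnAC -mulnA; nia.
  by rewrite gez0_abs //; lia.
have phi_inj : {in [predX L & 'I_q] &, injective phi}.
  move=> [y k] [y' k'] /andP[Ly _] /andP[Ly' _] e.
  have eqj j : (y j)%:Z - (p j)%:Z + f k 0 j = (y' j)%:Z - (p j)%:Z + f k' 0 j.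
    by apply: (@addIr _ (d.+2 * n)%N%:Z); rewrite -(phiE (y, k) j) e phiE.
  have kk' : k = k'.
    have Dk : (D %| ((k%:Z - k'%:Z) * w 0 0)%R)%Z.
      have -> : (k%:Z - k'%:Z) * w 0 0 =
          (shift_dot p (fun j => w j 0) y' - shift_dot p (fun j => w j 0) y)
          - (\sum_j f k 0 j * w j 0 - k%:Z * w 0 0)
          + (\sum_j f k' 0 j * w j 0 - k'%:Z * w 0 0).
        rewrite /shift_dot; set s1 := \sum_j _; set s2 := \sum_j _.
        set s3 := \sum_j _; set s4 := \sum_j _.
        suff -> : s1 = s2 + s3 - s4 by ring.
        rewrite -big_split -sumrB /=; apply: eq_bigr => j _.
        by rewrite -mulrDl eqj; ring.
      by rewrite rpredD ?fw // rpredB ?fw // rpredB ?Lw.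
    have g0 : (0 < g)%N by rewrite gcdn_gt0 absz_gt0 D0.
    have cop : coprime q (`|w 0%R 0%R| %/ g).
      by rewrite /coprime -(eqn_pmul2r g0) muln_gcdl !divnK ?mul1n ?dvdn_gcdl ?dvdn_gcdr.
    have qk : (q %| `|(k%:Z - k'%:Z)%R|)%N.
      rewrite -(Gauss_dvdl _ cop) -(dvdn_pmul2r g0) -mulnA !divnK ?dvdn_gcdl ?dvdn_gcdr //.
      by rewrite -abszM.
    apply: val_inj => /=; apply/eqP; move: qk (ltn_ord k) (ltn_ord k').
    move: (q) (k : nat) (k' : nat) => m a b mab am bm.
    by have := dvdn_leq _ mab; lia.
  subst k'; congr (_, _); apply/ffunP => j; apply: val_inj => /=.
  by have := eqj j; lia.
have <- : #|[predX L & 'I_q]| = (#|L| * q)%N by rewrite cardX card_ord.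
have -> : ((2 * d.+2 * n).+1 ^ d.+1)%N = #|{ffun 'I_d.+1 -> 'I_(2 * d.+2 * n).+1}|.
  by rewrite card_ffun !card_ord.
exact: (leq_card_in phi).
Qed.

(* With all but two coordinates fixed, completing squares in D |z|^2 = z.w gives an equation
   X^2 + Y^2 = M. *)
Lemma card_sphere (d n B T W : nat) (p : {ffun 'I_d.+2 -> 'I_n}) (D : int)
    (w : 'I_d.+2 -> int) (L : pred {ffun 'I_d.+2 -> 'I_n}) :
  tau_le B T -> (0 < T)%N -> D != 0 -> (forall j, `|w j| <= W)%N ->
  (2 * (2 * `|D| * n + W) ^ 2 <= B)%N ->
  (forall y, L y -> D * (\sum_j ((y j)%:Z - (p j)%:Z) ^+ 2) = shift_dot p w y) ->
  (#|L| <= n ^ d * (11 * T ^ 2))%N.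
Proof.
move=> tT T0 D0 wW WB Ly; pose k0 : 'I_d.+2 := ord0; pose k1 : 'I_d.+2 := lift ord0 ord0.
pose f (y : {ffun 'I_d.+2 -> 'I_n}) := [ffun j : 'I_d => y (lift ord0 (lift ord0 j))].
pose z (y : {ffun 'I_d.+2 -> 'I_n}) j := (y j)%:Z - (p j)%:Z.
pose g y := (2 * D * z y k0 - w k0, 2 * D * z y k1 - w k1).
have z_le y j : `|z y j| <= n%:Z.
  by rewrite /z; have := ltn_ord (y j); have := ltn_ord (p j); lia.
have -> : (n ^ d = #|{ffun 'I_d -> 'I_n}|)%N by rewrite card_ffun !card_ord.
apply: (leq_card_fibers (f := f)) => u; set P := [pred y | _].
have [y0 Py0|none] := pickP P; last by rewrite eq_card0.
pose h y := (g y).1 ^+ 2 + (g y).2 ^+ 2.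
have sameh y : P y -> h y = h y0.
  move=> Py; have /andP[/Ly Lyy /eqP fy] := Py; have /andP[/Ly Ly0 /eqP fy0] := Py0.
  have zE j : z y (lift ord0 (lift ord0 j)) = z y0 (lift ord0 (lift ord0 j)).
    by rewrite /z; move: fy; rewrite -fy0 => /ffunP/(_ j); rewrite !ffunE => ->.
  have hE v : D * (\sum_j (z v j) ^+ 2) = \sum_j z v j * w j ->
      h v = w k0 ^+ 2 + w k1 ^+ 2 + 4 * D * (\sum_j z v (lift ord0 (lift ord0 j)) *
        w (lift ord0 (lift ord0 j)) - D * \sum_j z v (lift ord0 (lift ord0 j)) ^+ 2).
    rewrite !big_ord_recl -/k0 -/k1 /h /g /=.
    set s := \sum_j _; set t := \sum_j _ => e.
    have -> : t = D * (z v k0 ^+ 2 + (z v k1 ^+ 2 + s)) - z v k0 * w k0 - z v k1 * w k1.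
      by rewrite e; ring.
    ring.
  rewrite (hE y Lyy) (hE y0 Ly0); congr (_ + 4 * D * (_ - D * _)).
    by apply: eq_bigr => j _; rewrite zE.
  by apply: eq_bigr => j _; rewrite zE.
have injg : {in P &, injective g}.
  move=> y y' Py Py' [/addIr e0 /addIr e1].
  have D2 : 2 * D != 0 by rewrite mulf_neq0.
  have /andP[_ /eqP fy] := Py; have /andP[_ /eqP fy'] := Py'.
  have zi j : z y j = z y' j -> y j = y' j.
    by move=> /addIr[e]; apply: val_inj.
  apply/ffunP => j; case: (unliftP ord0 j) => [j1|] ->; last by apply/zi/(mulfI D2).
  case: (unliftP ord0 j1) => [j2|] ->; last by apply/zi/(mulfI D2).
  by move: fy; rewrite -fy' => /ffunP/(_ j2); rewrite !ffunE.
have hB : (`|h y0| <= B)%N.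
  apply: leq_trans WB; rewrite -lez_nat gez0_abs ?addr_ge0 ?sqr_ge0 //.
  have sq j : (2 * D * z y0 j - w j) ^+ 2 <= ((2 * `|D| * n + W) ^ 2)%N%:Z.
    rewrite -[_ ^+ 2]real_normK ?num_real // -[X in _ <= X]natz natrX ler_sqr ?nnegrE //.
    apply: le_trans (ler_normB _ _) _; rewrite natrD lerD //; last first.
      by rewrite natz -abszE lez_nat.
    by rewrite !natrM !normrM !ler_pM ?mulr_ge0 ?normr_ge0 // natz ?abszE.
  by rewrite mul2n -addnn PoszD; apply: lerD (sq k0) (sq k1).
pose s := [seq g y | y <- enum P].
have us : uniq s.
  by rewrite map_inj_in_uniq ?enum_uniq // => y y'; rewrite !mem_enum; apply: injg.
have sh q : q \in s -> q.1 ^+ 2 + q.2 ^+ 2 = `|h y0|%N%:Z.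
  move=> /mapP[y]; rewrite mem_enum => Py ->; rewrite gez0_abs -?(sameh _ Py) //.
  by rewrite addr_ge0 ?sqr_ge0.
rewrite cardE -(size_map g) -/s.
(* The bound for sums of two squares requires a positive number; 0 has only the representation (0,
   0). *)
have [h0|h0] := posnP `|h y0|%N; last first.
  apply: leq_trans (size_sumsq h0 us sh) _.
  have t1 : (tau `|h y0| <= T)%N by apply: tT; rewrite h0.
  by rewrite expnS expn1; nia.
apply: (@leq_trans 1%N); last by rewrite muln_gt0 expn_gt0 T0.
apply: (@size_le_inj _ _ id s [:: (0, 0)]) => // q /sh; rewrite h0.
move/eqP; rewrite paddr_eq0 ?sqr_ge0 // !sqrf_eq0 => /andP[/eqP q1 /eqP q2].
by rewrite inE [q]surjective_pairing q1 q2.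
Qed.

Lemma card_hyperplane (F : numFieldType) (d n : nat) (p : {ffun 'I_d.+1 -> 'I_n})
    (v : 'I_d.+1 -> F) (k : 'I_d.+1) (L : pred {ffun 'I_d.+1 -> 'I_n}) :
  v k != 0 ->
  (forall y, L y -> \sum_j ((y j)%:R - (p j)%:R) * v j = 0) -> (#|L| <= n ^ d)%N.
Proof.
move=> vk Ly.
have -> : (n ^ d = #|{ffun 'I_d -> 'I_n}|)%N by rewrite card_ffun !card_ord.
pose f (y : {ffun 'I_d.+1 -> 'I_n}) := [ffun j : 'I_d => y (lift k j)].
apply: (leq_card_in f) => y y' /Ly e /Ly e' /ffunP fe.
have fj j : y (lift k j) = y' (lift k j) by have := fe j; rewrite !ffunE.
have yk : y k = y' k.
  apply: val_inj; apply/eqP; rewrite -(eqr_nat F); apply/eqP/(@addIr _ (- (p k)%:R)).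
  apply: (mulIf vk).
  have := etrans e (esym e'); rewrite (bigD1 k) //= [in X in _ = X](bigD1 k) //=.
  rewrite (eq_bigr (fun j => ((y' j)%:R - (p j)%:R) * v j)); first by move/addIr.
  by move=> j; rewrite eq_sym => /unlift_some[j' -> _]; rewrite fj.
by apply/ffunP => j; case: (unliftP k j) => [j'|] ->.
Qed.

(** With all coordinates but the first two fixed, the differences satisfy v0 dy0 + v1 dy1 = 0. So y1
    stays in one residue class modulo |v0| / gcd(v0, v1), and it determines y0. *)
Lemma card_hyperplane_gcd (d n : nat) (p : {ffun 'I_d.+2 -> 'I_n})
    (v : 'I_d.+2 -> int) (L : pred {ffun 'I_d.+2 -> 'I_n}) (v0 := v ord0)
    (v1 := v (lift ord0 ord0)) : v0 != 0 ->
  (forall y, L y -> shift_dot p v y = 0) ->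
  (#|L| <= n ^ d * (n %/ (`|v0| %/ gcdn `|v0| `|v1|)).+1)%N.
Proof.
move=> v00 Ly; pose k0 : 'I_d.+2 := ord0; pose k1 : 'I_d.+2 := lift ord0 ord0.
set g := gcdn _ _; set M := (_ %/ g)%N.
have g0 : (0 < g)%N by rewrite gcdn_gt0 absz_gt0 v00.
have M0 : (0 < M)%N by rewrite divn_gt0 // dvdn_leq ?absz_gt0 // dvdn_gcdl.
pose f (y : {ffun 'I_d.+2 -> 'I_n}) := [ffun j : 'I_d => y (lift ord0 (lift ord0 j))].
have -> : (n ^ d = #|{ffun 'I_d -> 'I_n}|)%N by rewrite card_ffun !card_ord.
apply: (leq_card_fibers (f := f)) => u; set P := [pred y | _].
have key y y' : y \in P -> y' \in P ->
    ((y k0)%:Z - (y' k0)%:Z) * v0 + ((y k1)%:Z - (y' k1)%:Z) * v1 = 0.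
  move=> /andP[/Ly e /eqP fy] /andP[/Ly e' /eqP fy'].
  have := etrans e (esym e'); rewrite /shift_dot !big_ord_recl -/k0 -/k1 -/v0 -/v1.
  rewrite (eq_bigr (fun j => ((y' (lift ord0 (lift ord0 j)))%:Z -
     (p (lift ord0 (lift ord0 j)))%:Z) * v (lift ord0 (lift ord0 j)))).
    set s := \sum_j _; set a := (y k0)%:Z; set a' := (y' k0)%:Z.
    set b := (y k1)%:Z; set b' := (y' k1)%:Z => ee.
    have -> : (a - a') * v0 + (b - b') * v1 =
      ((a - (p k0)%:Z) * v0 + ((b - (p k1)%:Z) * v1 + s)) -
      ((a' - (p k0)%:Z) * v0 + ((b' - (p k1)%:Z) * v1 + s)) by ring.
    by rewrite ee subrr.
  by move=> j _; move: fy; rewrite -fy' => /ffunP/(_ j); rewrite !ffunE => ->.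
pose pr (y : {ffun 'I_d.+2 -> 'I_n}) : 'I_n := y k1.
have Pinj : {in P &, injective pr}.
  rewrite /pr => y y' Py Py' y1; have := key y y' Py Py'; rewrite y1 subrr mul0r addr0.
  move/eqP; rewrite mulf_eq0 (negbTE v00) orbF subr_eq0 => /eqP[y0].
  have /andP[_ /eqP fy] := Py; have /andP[_ /eqP fy'] := Py'.
  apply/ffunP => j; case: (unliftP ord0 j) => [j1|] ->; last exact: val_inj.
  case: (unliftP ord0 j1) => [j2|] ->; last exact: y1.
  by move: fy; rewrite -fy' => /ffunP/(_ j2); rewrite !ffunE.
rewrite -(card_in_image Pinj); set Q := image _ _.
apply: (@leq_trans #|[pred t in Q]|); first exact/eq_leq/eq_card.
apply: card_residue_class M0 _ => _ _ /imageP[y Py ->] /imageP[y' Py' ->]; rewrite /pr.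
suff : (M %| (y k1)%:Z - (y' k1)%:Z)%Z by rewrite -eqz_mod_dvd !modz_nat => /eqP[].
have /dvdzP[v1' v1E] : (g %| v1)%Z by exact: dvdn_gcdr.
have cop : coprimez M%:Z v1'.
  rewrite /coprimez /gcdz /= eqz_nat -(eqn_pmul2r g0) muln_gcdl.
  by rewrite divnK ?dvdn_gcdl // -[X in gcdn _ (_ * X)]absz_nat -abszM -v1E mul1n.
have g0' : g%:Z != 0 by rewrite -lt0n.
rewrite -(Gauss_dvdzl _ cop) -(dvdz_mul2r g0') -mulrA -v1E -PoszM.
rewrite divnK ?dvdn_gcdl // -[_ * v1](addKr (((y k0)%:Z - (y' k0)%:Z) * v0)).
rewrite key // addr0 rpredN.
rewrite [X in is_true X](_ : _ = (`|v0| %| `|(((y k0)%:Z - (y' k0)%:Z) * v0)%R|)%N) //.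
by rewrite abszM dvdn_mull.
Qed.

(** * The resultant of D and w_1 *)

Lemma eq_cofactor (r : nat) (Z Z' : 'M[int]_r) i j :
  (forall k l, k != i -> l != j -> Z k l = Z' k l) -> cofactor Z i j = cofactor Z' i j.
Proof.
move=> e; rewrite /cofactor; congr (_ * \det _).
by apply/matrixP => a b; rewrite !mxE e // eq_sym neq_lift.
Qed.

Lemma cofactor_le (r n : nat) (Z : 'M[int]_r.+1) i j :
  (0 < n)%N -> (forall i j, `|Z i j| <= n)%N -> (`|cofactor Z i j| <= r.+1`! * n ^ r.+1)%N.
Proof.
move=> n0 Zn; rewrite abszMsign (leq_trans (det_le (b := n) _)) //.
  by move=> a b; rewrite !mxE.
by rewrite leq_mul ?leq_pexp2l // factS leq_pmull.
Qed.

Definition set_mx (r : nat) (Z : 'M[int]_r) (i0 j0 : 'I_r) (t : int) : 'M[int]_r :=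
  \matrix_(i, j) if (i == i0) && (j == j0) then t else Z i j.

(** Either the varying entry lies in the deleted row and the cofactor is constant, or expansion
    along the row of that entry is affine in it. *)
Lemma cofactor_set_mx_affine (r : nat) (Z : 'M[int]_r) (i0 j0 i j : 'I_r) (t : int) :
  cofactor (set_mx Z i0 j0 t) i j =
    (cofactor (set_mx Z i0 j0 1) i j - cofactor (set_mx Z i0 j0 0) i j) * t
    + cofactor (set_mx Z i0 j0 0) i j.
Proof.
have eqi (s s' : int) k l : (k != i0) || (l != j0) ->
    set_mx Z i0 j0 s k l = set_mx Z i0 j0 s' k l.
  by rewrite !mxE -negb_and => /negbTE ->.
have [ii0|ii0] := eqVneq i i0.
  have c s : cofactor (set_mx Z i0 j0 s) i j = cofactor (set_mx Z i0 j0 0) i j.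
    by apply: eq_cofactor => k l ki _; apply: eqi; rewrite -ii0 ki.
  by rewrite (c t) (c 1) subrr mul0r add0r.
case: (unliftP i i0) ii0 => [a i0E|->]; last by rewrite eqxx.
move=> _; rewrite /cofactor; set M := fun s => row' i (col' j (set_mx Z i0 j0 s)).
rewrite -!/(M _) -mulrBr -mulrA -mulrDr; congr (_ * _).
rewrite !(expand_det_row _ a) -sumrB mulr_suml -big_split /=.
have cM s l : cofactor (M s) a l = cofactor (M 0) a l.
  apply: eq_cofactor => k b ka _; by rewrite !mxE i0E (inj_eq (@lift_inj _ i)) (negbTE ka).
apply: eq_bigr => l _; rewrite !(cM t) (cM 1) /M !mxE -mulrBl.
by case: ifP => _; ring.
Qed.

Definition sq_col (r : nat) (Z : 'M[int]_r) : 'cV[int]_r := \col_i \sum_j Z i j ^+ 2.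

(* The sphere through 0 and the rows of Z has center center_num Z / (2 det Z). *)
Definition center_num (r : nat) (Z : 'M[int]_r) : 'cV[int]_r := \adj Z *m sq_col Z.

(* With s = Z ord_max ord0 and w = center_num Z, cof0, det_rest and center_rest are the N, e
   and f of the decompositions det Z = N s + e and w_0 = N s^2 + f. *)
Definition cof0 (r : nat) (Z : 'M[int]_r.+1) := cofactor Z ord_max ord0.

Definition det_rest (r : nat) (Z : 'M[int]_r.+1) : int :=
  \sum_(j | j != ord0) Z ord_max j * cofactor Z ord_max j.

Definition center_rest (r : nat) (Z : 'M[int]_r.+1) : int :=
  cof0 Z * (\sum_(j | j != ord0) Z ord_max j ^+ 2) +
  \sum_(i | i != ord_max) cofactor Z i ord0 * \sum_j Z i j ^+ 2.

Definition resultant0 (r : nat) (Z : 'M[int]_r.+1) : int :=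
  det_rest Z ^+ 2 + cof0 Z * center_rest Z.

Lemma det_split (r : nat) (Z : 'M[int]_r.+1) :
  \det Z = Z ord_max ord0 * cof0 Z + det_rest Z.
Proof. by rewrite (expand_det_row _ ord_max) (bigD1 ord0). Qed.

Lemma center_split (r : nat) (Z : 'M[int]_r.+1) :
  center_num Z ord0 0 = cof0 Z * Z ord_max ord0 ^+ 2 + center_rest Z.
Proof.
rewrite mxE (bigD1 ord_max) //= !mxE (bigD1 ord0) //= -/(cof0 Z) mulrDr -addrA.
by congr (_ + (_ + _)); apply: eq_bigr => i _; rewrite !mxE.
Qed.

(** Eliminating s from D = N s + e and w_0 = N s^2 + f gives N w_0 - D (D - 2 e) = e^2 + N f. *)
Lemma gcd_dvd_resultant0 (r : nat) (Z : 'M[int]_r.+1) :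
  (gcdn `|\det Z| `|center_num Z ord0 0%R| %| `|resultant0 Z|)%N.
Proof.
set g := gcdn _ _; rewrite -[(_ %| _)%N]/(g%:Z %| resultant0 Z)%Z.
have -> : resultant0 Z = cof0 Z * center_num Z ord0 0 -
    \det Z * (\det Z - 2 * det_rest Z).
  by rewrite center_split det_split /resultant0; ring.
rewrite rpredB //; first by rewrite dvdz_mull //; exact: dvdn_gcdr.
by rewrite dvdz_mulr //; exact: dvdn_gcdl.
Qed.

(** Independence from the entry s is what [one_weight_bound] demands of its [c]. *)
Lemma eq_resultant0 (r : nat) (Z Z' : 'M[int]_r.+1) :
  (forall i j, (i != ord_max) || (j != ord0) -> Z i j = Z' i j) ->
  resultant0 Z = resultant0 Z'.
Proof.
move=> e.
have eN : cof0 Z = cof0 Z' by apply: eq_cofactor => k l km _; rewrite e ?km.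
congr (_ ^+ 2 + _ * _); rewrite ?eN //.
  apply: eq_bigr => j j0; rewrite e ?j0 ?orbT //; congr (_ * _).
  by apply: eq_cofactor => k l km _; rewrite e ?km.
rewrite /center_rest eN; congr (_ * _ + _).
  by apply: eq_bigr => j j0; rewrite e ?j0 ?orbT.
apply: eq_bigr => i im; congr (_ * _).
  by apply: eq_cofactor => k l _ l0; rewrite e ?l0 ?orbT.
by apply: eq_bigr => j _; rewrite e ?im.
Qed.

(** In the second entry t of the last row, e is affine with slope the cofactor N' of t, while f is N
    t^2 plus an affine function. Hence e^2 + N f has leading coefficient N^2 + N'^2. *)
Lemma resultant0_quadratic (r : nat) (Z : 'M[int]_r.+2) (k1 := lift ord0 ord0 : 'I_r.+2) :
  exists b c, forall t, resultant0 (set_mx Z ord_max k1 t) =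
    (cof0 Z ^+ 2 + cofactor Z ord_max k1 ^+ 2) * t ^+ 2 + b * t + c.
Proof.
pose S t := set_mx Z ord_max k1 t.
have k10 : k1 != ord0 by [].
have cm t j : cofactor (S t) ord_max j = cofactor Z ord_max j.
  by apply: eq_cofactor => k l km _; rewrite mxE (negbTE km).
have Sm t : S t ord_max k1 = t by rewrite mxE !eqxx.
have Sj t j : j != k1 -> S t ord_max j = Z ord_max j.
  by move=> jk; rewrite mxE (negbTE jk) andbF.
have Si t i j : i != ord_max -> S t i j = Z i j by move=> im; rewrite mxE (negbTE im).
pose e1 := \sum_(j | (j != ord0) && (j != k1)) Z ord_max j * cofactor Z ord_max j.
have eE t : det_rest (S t) = cofactor Z ord_max k1 * t + e1.
  rewrite /det_rest (bigD1 k1) //= Sm cm mulrC; congr (_ + _).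
  by apply: eq_bigr => j /andP[_ jk]; rewrite Sj // cm.
pose f1 := \sum_(j | (j != ord0) && (j != k1)) Z ord_max j ^+ 2.
pose v i := \sum_j Z i j ^+ 2.
pose g s := \sum_(i | i != ord_max) cofactor (S s) i ord0 * v i.
have gE t : g t = (g 1 - g 0) * t + g 0.
  rewrite /g -sumrB mulr_suml -big_split /=; apply: eq_bigr => i _.
  by rewrite [in LHS]cofactor_set_mx_affine -/(S _); ring.
have fE t : center_rest (S t) = cof0 Z * (t ^+ 2 + f1) + ((g 1 - g 0) * t + g 0).
  rewrite /center_rest /cof0 cm -gE; congr (_ * _ + _).
    rewrite (bigD1 k1) //= Sm; congr (_ + _).
    by apply: eq_bigr => j /andP[_ jk]; rewrite Sj.
  apply: eq_bigr => i im; congr (_ * _).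
  by apply: eq_bigr => j _; rewrite Si.
exists (2 * cofactor Z ord_max k1 * e1 + cof0 Z * (g 1 - g 0)).
exists (e1 ^+ 2 + cof0 Z * (cof0 Z * f1 + g 0)) => t.
rewrite /resultant0 -/(S t) eE fE /cof0 cm; ring.
Qed.

Lemma card_quadratic_roots (n : nat) (a b c x : int) (P : pred 'I_n) : a != 0 ->
  (forall t, P t -> a * (t%:Z - x) ^+ 2 + b * (t%:Z - x) + c = 0) -> (#|P| <= 2)%N.
Proof.
move=> a0 r; rewrite leqNgt; apply/negP => /card_gt2P[t1 [t2 [t3 [[]]]]].
move=> /r r1 /r r2 /r r3 [n12 n23 n31].
have key (s t : 'I_n) : a * (s%:Z - x) ^+ 2 + b * (s%:Z - x) + c = 0 ->
    a * (t%:Z - x) ^+ 2 + b * (t%:Z - x) + c = 0 -> s != t ->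
    a * (s%:Z + t%:Z - 2 * x) + b = 0.
  move=> es et st; have st' : s%:Z - t%:Z != 0.
    by rewrite subr_eq0; apply: contraNneq st => -[/val_inj ->].
  apply: (mulfI st'); rewrite mulr0 -[RHS](subrr 0) -{1}es -{1}et; ring.
have e1 := key _ _ r1 r2 n12; have e2 := key _ _ r2 r3 n23.
have : a * (t3%:Z - t1%:Z) = 0 by rewrite -[RHS](subrr 0) -{1}e2 -{1}e1; ring.
move/eqP; rewrite mulf_eq0 (negbTE a0) subr_eq0 /= => /eqP[/val_inj t31].
by rewrite t31 eqxx in n31.
Qed.

Lemma absz_addr_le (a b : int) : (`|(a + b)%R| <= `|a| + `|b|)%N.
Proof. by lia. Qed.

Lemma abs_sum_le (I : finType) (P : pred I) (F : I -> int) (b : nat) :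
  (forall i, P i -> `|F i| <= b)%N -> (`|(\sum_(i | P i) F i)%R| <= #|I| * b)%N.
Proof.
move=> Fb; rewrite -lez_nat abszE; apply: le_trans (ler_norm_sum _ _ _) _.
apply: (@le_trans _ _ (\sum_(i | P i) b%:Z)).
  by apply: ler_sum => i Pi; rewrite -abszE lez_nat Fb.
by rewrite sumr_const -mulr_natl natz -PoszM lez_nat leq_mul2r max_card orbT.
Qed.

Lemma center_num_le (r n : nat) (Z : 'M[int]_r.+1) i : (0 < n)%N ->
  (forall i j, `|Z i j| <= n)%N ->
  (`|center_num Z i 0%R| <= r.+1 ^ 2 * n ^ 2 * (r.+1`! * n ^ r.+1))%N.
Proof.
move=> n0 Zn; rewrite mxE.
have -> : (r.+1 ^ 2 * n ^ 2 * (r.+1`! * n ^ r.+1) =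
  #|{: 'I_r.+1}| * ((r.+1`! * n ^ r.+1) * (#|{: 'I_r.+1}| * n ^ 2)))%N.
  by rewrite card_ord; ring.
apply: abs_sum_le => j _; rewrite abszM leq_mul //.
  by rewrite mxE; apply: cofactor_le.
by rewrite mxE; apply: abs_sum_le => k _; rewrite abszX leq_exp2r.
Qed.

Lemma resultant0_le (r n : nat) (Z : 'M[int]_r.+1) : (0 < n)%N ->
  (forall i j, `|Z i j| <= n)%N ->
  (`|resultant0 Z| <= 3 * (r.+1 * n * (r.+1`! * n ^ r.+1)) ^ 2)%N.
Proof.
move=> n0 Zn; set F := (r.+1`! * n ^ r.+1)%N.
have cF i j : (`|cofactor Z i j| <= F)%N by apply: cofactor_le.
have sq (P : pred 'I_r.+1) i : (`|(\sum_(j | P j) Z i j ^+ 2)%R| <= r.+1 * n ^ 2)%N.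
  have := @abs_sum_le _ P (fun j => Z i j ^+ 2) (n ^ 2); rewrite card_ord; apply.
  by move=> j _; rewrite abszX leq_exp2r.
have e_le : (`|det_rest Z| <= r.+1 * (n * F))%N.
  have := @abs_sum_le _ (fun j => j != ord0)
    (fun j => Z ord_max j * cofactor Z ord_max j) (n * F).
  by rewrite card_ord; apply => j _; rewrite abszM leq_mul.
have s_le : (`|(\sum_(i | i != ord_max) cofactor Z i ord0 * \sum_j Z i j ^+ 2)%R|
    <= r.+1 * (F * (r.+1 * n ^ 2)))%N.
  have := @abs_sum_le _ (fun i => i != ord_max)
    (fun i => cofactor Z i ord0 * \sum_j Z i j ^+ 2) (F * (r.+1 * n ^ 2)).
  by rewrite card_ord; apply => i _; rewrite abszM leq_mul.
have f_le : (`|center_rest Z| <= 2 * (r.+1 * n) ^ 2 * F)%N.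
  apply: leq_trans (absz_addr_le _ _) _.
  have -> : (2 * (r.+1 * n) ^ 2 * F =
      r.+1 * (F * (r.+1 * n ^ 2)) + r.+1 * (F * (r.+1 * n ^ 2)))%N.
    by ring.
  rewrite leq_add // abszM (leq_trans (leq_mul (cF _ _) (sq _ _))) //.
  by rewrite leq_pmull.
apply: leq_trans (absz_addr_le _ _) _.
have -> : (3 * (r.+1 * n * F) ^ 2 = (r.+1 * (n * F)) ^ 2 + F * (2 * (r.+1 * n) ^ 2 * F))%N.
  by ring.
rewrite leq_add // ?abszX ?leq_exp2r // abszM.
exact: leq_mul (cF _ _) f_le.
Qed.

(** * Counting bad configurations *)

(** The indices of x_1, ..., x_d: [ord0] is the base point and [ord_max] the last point x_(d+1). *)
Definition base_rows (d : nat) (i : 'I_d) : 'I_d.+2 := lift ord0 (lift ord_max i).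

Lemma base_rows_inj d : injective (@base_rows d).
Proof. by move=> i j /lift_inj/lift_inj. Qed.

Lemma base_rows_neq_max d (i : 'I_d) : base_rows i != ord_max.
Proof. by rewrite -val_eqE /= /bump !leq0n leqNgt ltn_ord add1n neq_ltn ltnS ltn_ord. Qed.

Definition base_mx (d n : nat) (X : config 'I_d.+2 'I_d n) : 'M[int]_d :=
  dif_mx ord0 (@base_rows d) id X.

(** The point x_(d+1) lies on the sphere through the affinely independent x_0, ..., x_d, with the
    equation cleared of its denominator D. *)
Definition bad_sphere (d n : nat) (X : config 'I_d.+2 'I_d n) : bool :=
  (\det (base_mx X) != 0) &&
  (\det (base_mx X) * (\sum_j ((X ord_max j)%:Z - (X ord0 j)%:Z) ^+ 2) ==
     shift_dot (X ord0) (fun j => center_num (base_mx X) j 0) (X ord_max)).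

(* Dominates every integer to which the divisor bound is applied. *)
Definition big_bound (d n : nat) : nat := (18 * d ^ 4 * n ^ 4 * (d`! * n ^ d) ^ 2)%N.

Lemma fact_exp_le_bound d n k : (0 < d)%N -> (0 < n)%N -> (k <= d)%N ->
  (k`! * n ^ k <= big_bound d n)%N.
Proof.
move=> d0 n0 kd; apply: (@leq_trans (d`! * n ^ d)%N).
  by apply: leq_mul; [exact: leq_fact | exact: leq_pexp2l].
rewrite /big_bound -[X in (_ <= _ * X)%N]mulnn mulnA leq_pmull //.
by rewrite !muln_gt0 !expn_gt0 fact_gt0 d0 n0.
Qed.

Lemma base_mx_le d n (X : config 'I_d.+2 'I_d n) i j : (`|base_mx X i j| <= n)%N.
Proof. by rewrite mxE dif_le. Qed.

Lemma base_mx_put_max d n (X : config 'I_d.+2 'I_d n) p :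
  base_mx (put_point ord_max X p) = base_mx X.
Proof.
by apply/matrixP => i j; rewrite !mxE dif_put_point // (negbTE (base_rows_neq_max _)).
Qed.

Lemma divn_quotient (m D g : nat) : (0 < D)%N -> (g %| D)%N -> (m * g %/ D = m %/ (D %/ g))%N.
Proof.
move=> D0 gD; have g0 := dvdn_gt0 D0 gD.
by rewrite -{1}(divnK gD) divnMr.
Qed.

Lemma sum_pred_card (S : finType) (L : pred S) : (\sum_y L y = #|L|)%N.
Proof.
rewrite -sum1_card [RHS]big_mkcond; apply: eq_bigr => y _.
by rewrite /= unfold_in -/(L y); case: (L y).
Qed.

(** For fixed x_0, ..., x_d the admissible x_(d+1) are counted twice. If the weight is n, the bound
    n^(d-2) 11 T^2 from two squares is used; otherwise the lattice count, a constant times 1 + n^d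
    gcd(D, w_0) / |D|. *)
Lemma sum_bad_sphere_le (e n T : nat) (d := e.+3) : (0 < n)%N -> (0 < T)%N ->
  tau_le (big_bound d n) T ->
  (n ^ d * \sum_(X : config 'I_d.+2 'I_d n) bad_sphere X <=
   \sum_(X : config 'I_d.+2 'I_d n) n ^ e * (11 * T ^ 2 * (2 * d.+1).+1 ^ d *
      (1 + gcd_weight n d (\det (base_mx X)) (center_num (base_mx X) ord0 0%R))))%N.
Proof.
move=> n0 T0 tT; rewrite -[X in (n ^ X * _)%N]card_ord.
apply: (sum_put_point (i := ord_max)) => X.
set Z := base_mx X; set D := \det Z; set w := center_num Z.
pose L y := bad_sphere (put_point ord_max X y).
have LE y : L y -> D != 0 /\
    D * (\sum_j ((y j)%:Z - (X ord0 j)%:Z) ^+ 2) = shift_dot (X ord0) (fun j => w j 0) y.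
  rewrite /L /bad_sphere base_mx_put_max -/Z -/D => /andP[D0 /eqP].
  by rewrite !ffunE !eqxx /= => ->.
rewrite (sum_pred_card L).
have [y0 Ly0|none] := pickP L; last by rewrite eq_card0.
have [D0 _] := LE _ Ly0.
have Zn i j : (`|Z i j| <= n)%N by apply: base_mx_le.
have Dw i : (Z *m w) i 0 = D * sq_col Z i 0.
  by rewrite /w /center_num mulmxA mul_mx_adj mul_scalar_mx mxE.
have c1 : (#|L| * (`|D| %/ gcdn `|D| `|w ord0 0%R|) <= ((2 * d.+1).+1 * n) ^ d)%N.
  apply: leq_trans (card_lattice (p := X ord0) (Z := Z) (w := w) D0 Zn _ _) _.
  - by move=> i; rewrite Dw dvdz_mulr.
  - by move=> y /LE[_ <-]; rewrite dvdz_mulr.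
  by rewrite leq_exp2r // mulSn; lia.
have c2 : (#|L| <= n ^ e.+1 * (11 * T ^ 2))%N.
  apply: (card_sphere (p := X ord0) (w := fun j => w j 0) tT T0 D0
    (W := (d ^ 2 * n ^ 2 * (d`! * n ^ d))%N)).
  - by move=> j; apply: center_num_le.
  - have DF : (`|D| <= d`! * n ^ d)%N by apply: det_le.
    rewrite /big_bound; set F := (d`! * n ^ d)%N in DF *.
    have -> : (18 * d ^ 4 * n ^ 4 * F ^ 2 = 2 * (3 * (d ^ 2 * n ^ 2 * F)) ^ 2)%N by ring.
    rewrite leq_mul2l leq_exp2r //=.
    have -> : (3 * (d ^ 2 * n ^ 2 * F) = 2 * (F * (d ^ 2 * n ^ 2)) + d ^ 2 * n ^ 2 * F)%N by ring.
    rewrite leq_add2r -mulnA leq_mul2l leq_mul //= -expnMn.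
    apply: (@leq_trans (d * n)%N); first by rewrite leq_pmull.
    by rewrite -mulnn leq_pmull // muln_gt0 n0.
  by move=> y /LE[].
rewrite /gcd_weight -/D (negbTE D0) -/w; set g := gcdn _ _.
have gD : (g %| `|D|)%N by exact: dvdn_gcdl.
have D0' : (0 < `|D|)%N by rewrite absz_gt0.
rewrite divn_quotient //; set q := (`|D| %/ g)%N.
have g0 : (0 < g)%N by apply: dvdn_gt0 D0' gD.
have q0 : (0 < q)%N by rewrite divn_gt0 // dvdn_leq.
set C1 := ((2 * d.+1).+1 ^ d)%N.
have C10 : (0 < C1)%N by rewrite expn_gt0.
have T2 : (0 < 11 * T ^ 2)%N by rewrite muln_gt0 expn_gt0 T0.
have [nq|qn] := leqP n (n ^ d %/ q).
  apply: leq_trans c2 _.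
  rewrite expnSr -mulnA leq_mul2l; apply/orP; right.
  rewrite [X in (X <= _)%N]mulnC -[X in (_ <= X)%N]mulnA leq_mul2l; apply/orP; right.
  by rewrite (leq_trans (leq_addl 1 n)) // leq_pmull.
apply: (@leq_trans (C1 * (1 + n ^ d %/ q))%N); last first.
  rewrite mulnA leq_mul2r; apply/orP; right.
  by rewrite mulnA leq_pmull // muln_gt0 expn_gt0 n0.
rewrite -(leq_pmul2r q0); apply: leq_trans c1 _.
rewrite expnMn -mulnA leq_mul2l; apply/orP; right.
by rewrite add1n ltnW // ltn_ceil.
Qed.

Lemma base_mx_put (d n : nat) (X : config 'I_d.+2 'I_d n) (i j : 'I_d) t :
  base_mx (put_entry (base_rows i) j X t) =
    set_mx (base_mx X) i j (t%:Z - (X ord0 j)%:Z).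
Proof.
by apply/matrixP => k l; rewrite !mxE dif_put // (inj_eq (@base_rows_inj d)).
Qed.

Lemma gcd_weight_mono n r (D c c' : int) : (gcdn `|D| `|c| %| `|c'|)%N ->
  (gcd_weight n r D c <= gcd_weight n r D c')%N.
Proof.
rewrite /gcd_weight; case: eqVneq => // D0 gc.
have h : (gcdn `|D| `|c| <= gcdn `|D| `|c'|)%N.
  by rewrite dvdn_leq ?gcdn_gt0 ?absz_gt0 ?D0 // dvdn_gcd dvdn_gcdl.
by rewrite leq_min geq_minl (leq_trans (geq_minr _ _)) // leq_div2r // leq_mul2l h orbT.
Qed.

Lemma leq_gcd_weight0 n r (D : int) : ((D == 0%R) * n <= gcd_weight n r D 1)%N.
Proof. by rewrite /gcd_weight; case: eqP; rewrite ?mul1n ?mul0n. Qed.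

Definition weight_const (T r : nat) : nat := ((100 * T ^ 4) ^ r)%N.

(* R = 0 is rare: if N <> 0, then R is quadratic in the second coordinate of the last row,
   with leading coefficient at least N^2. *)
Lemma sum_center_weight_le (e n T : nat) (d := e.+2) : (0 < n)%N -> (0 < T)%N ->
  tau_le (big_bound d n) T ->
  (\sum_(X : config 'I_d.+2 'I_d n)
      gcd_weight n d (\det (base_mx X)) (center_num (base_mx X) ord0 0%R) <=
   (4 * weight_const T d) * #|{: config 'I_d.+2 'I_d n}|)%N.
Proof.
move=> n0 T0 tT; set Om := #|_|.
pose R (X : config 'I_d.+2 'I_d n) := resultant0 (base_mx X).
pose N (X : config 'I_d.+2 'I_d n) := cof0 (base_mx X).
have nB k : (k <= d)%N -> (k`! * n ^ k <= big_bound d n)%N.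
  by move=> kd; apply: fact_exp_le_bound.
have H1 : (\sum_X (R X != 0%R) * gcd_weight n d (\det (base_mx X)) (R X)
    <= weight_const T d * Om)%N.
  have WB := weight_bound (J := 'I_d) (o := (ord0 : 'I_d.+2)) n0 T0 nB tT.
  apply: (WB (@base_rows d) id R (@base_rows_inj d) (@inj_id _)) => //.
  - move=> X; apply: leq_trans (resultant0_le n0 (base_mx_le X)) _.
    rewrite /big_bound; set F := (d`! * n ^ d)%N.
    have -> : (18 * d ^ 4 * n ^ 4 * F ^ 2 = 3 * (d * n * F) ^ 2 * (6 * d ^ 2 * n ^ 2))%N by ring.
    by rewrite leq_pmulr // !(muln_gt0, expn_gt0) n0.
  - move=> i j id j0 X t; apply: eq_resultant0 => k l kl.
    rewrite base_mx_put mxE.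
    have -> : i = ord_max by apply: val_inj => /=; case: id.
    have -> : j = ord0 by apply: val_inj.
    by case/orP: kl => /negbTE ->; rewrite ?andbF.
(* N is up to sign a minor of order d-1, and where it vanishes its weight against 1 is n; so the
   weight bound controls n times the probability of N = 0. *)
have H2 : (\sum_X (N X == 0%R) * n <= weight_const T e.+1 * Om)%N.
  have nB' k : (k <= e.+1)%N -> (k`! * n ^ k <= big_bound d n)%N by move/leqW/nB.
  have i1 : injective (@base_rows d \o lift ord_max).
    by move=> i j /base_rows_inj/lift_inj.
  have WB := weight_bound (J := 'I_d) (o := (ord0 : 'I_d.+2)) n0 T0 nB' tT.
  apply: leq_trans (WB (@base_rows d \o lift ord_max) (lift ord0) (fun=> 1) i1
    (@lift_inj _ ord0) _ _ _) => //; last by move=> X; apply: (nB 0).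
  apply: leq_sum => X _; rewrite mul1n.
  rewrite (@eq_gcd_weight _ _ _ (N X) _ 1) ?leq_gcd_weight0 //.
  by rewrite -[N X]/(last_cof _ _ _ _ _) abs_last_cof.
have H3 : (\sum_X ((N X != 0%R) && (R X == 0%R)) * n <= \sum_(X : config 'I_d.+2 'I_d n) 2)%N.
  pose k1 : 'I_d := lift ord0 ord0.
  apply: (sum_put_entry (i := base_rows ord_max) (j := k1)) => // X.
  rewrite -big_distrl /= mulnC leq_mul2l; apply/orP; right.
  have NE t : N (put_entry (base_rows ord_max) k1 X t) = N X.
    rewrite /N base_mx_put; apply: eq_cofactor => k l km _.
    by rewrite mxE (negbTE km).
  have [N0|N0] := eqVneq (N X) 0; first by rewrite big1 // => t _; rewrite NE N0 eqxx.
  have [b [c RE]] := resultant0_quadratic (base_mx X).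
  have a0 : cof0 (base_mx X) ^+ 2 + cofactor (base_mx X) ord_max k1 ^+ 2 != 0.
    by rewrite paddr_eq0 ?sqr_ge0 // !sqrf_eq0 (negbTE N0).
  pose P (t : 'I_n) := R (put_entry (base_rows ord_max) k1 X t) == 0.
  apply: leq_trans (card_quadratic_roots (P := P) (b := b) (c := c)
    (x := (X ord0 k1)%:Z) a0 _).
    rewrite -sum1_card [X in (_ <= X)%N]big_mkcond /=; apply: leq_sum => t _.
    by rewrite NE N0 /= unfold_in -/(P t); case: (P t).
  by move=> t /eqP; rewrite /R base_mx_put -RE.
(* Three cases: for R != 0 the gcd with w_0 is replaced by the gcd with R; for N = 0, and for R = 0
   with N != 0, the weight is at most n. *)
apply: (@leq_trans (\sum_(X : config 'I_d.+2 'I_d n)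
    (((R X != 0%R) * gcd_weight n d (\det (base_mx X)) (R X) + (N X == 0%R) * n) +
      ((N X != 0%R) && (R X == 0%R)) * n))%N).
  apply: leq_sum => X _; apply: leq_trans (gcd_weight_mono _ _ (gcd_dvd_resultant0 _)) _.
  rewrite -/(R X); case: (R X =P 0) => _; last by rewrite /= mul1n -addnA leq_addr.
  case: (N X =P 0) => _ /=; rewrite ?mul0n ?mul1n ?add0n ?addn0; exact: gcd_weight_le.
rewrite !big_split /=; apply: leq_trans (leq_add (leq_add H1 H2) H3) _.
rewrite sum_nat_const -/Om.
have W0 k : (0 < weight_const T k)%N by rewrite expn_gt0 muln_gt0 expn_gt0 T0.
have WW : (weight_const T e.+1 <= weight_const T d)%N.
  by rewrite [weight_const T d]expnS leq_pmull // muln_gt0 expn_gt0 T0.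
have := W0 d; nia.
Qed.

(** * Configurations on a common hyperplane *)

Definition row_dif (F : numFieldType) (I : finType) (d n : nat) (o : I)
    (X : config I 'I_d n) (i : I) : 'rV[F]_d :=
  \row_j ((X i j)%:R - (X o j)%:R).

Definition hyper_mx (F : numFieldType) (d n : nat) (X : config 'I_d.+3 'I_d.+1 n) :
    'M[F]_(d, d.+1) :=
  \matrix_i row_dif F ord0 X (base_rows (lift ord_max i)).

(* z_d and z_(d+1) lie in the span of z_1, ..., z_(d-1), which may have smaller dimension. *)
Definition bad_hyperplane (F : numFieldType) (d n : nat)
    (X : config 'I_d.+3 'I_d.+1 n) : bool :=
  (row_dif F ord0 X (base_rows ord_max) <= hyper_mx F X)%MS &&
  (row_dif F ord0 X ord_max <= hyper_mx F X)%MS.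

Lemma row_dif_put (F : numFieldType) (I : finType) (d n : nat) (o i k : I)
    (X : config I 'I_d n) p : i != o ->
  row_dif F o (put_point i X p) k =
    if k == i then \row_j ((p j)%:R - (X o j)%:R) else row_dif F o X k.
Proof.
move=> io; apply/rowP => j; rewrite mxE !ffunE [o == i]eq_sym (negbTE io).
by case: (k =P i) => _; rewrite mxE.
Qed.

Lemma hyper_mx_put (F : numFieldType) (d n : nat) (X : config 'I_d.+3 'I_d.+1 n) i p :
  i != ord0 -> (forall k, base_rows (lift ord_max k) != i) ->
  hyper_mx F (put_point i X p) = hyper_mx F X.
Proof.
move=> i0 ik; apply/row_matrixP => k; rewrite !rowK row_dif_put //.
by rewrite (negbTE (ik k)).
Qed.

(** The rank is below the dimension, so a nonzero column of the cokernel is a nontrivial linear form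
    vanishing on the row space. *)
Lemma card_rowspace (F : numFieldType) (d n : nat) (M : 'M[F]_(d, d.+1))
    (p : {ffun 'I_d.+1 -> 'I_n}) (L : pred {ffun 'I_d.+1 -> 'I_n}) :
  (forall y, L y -> ((\row_j ((y j)%:R - (p j)%:R) : 'rV[F]_d.+1) <= M)%MS) ->
  (#|L| <= n ^ d)%N.
Proof.
move=> LM; have : cokermx M != 0.
  rewrite -mxrank_eq0 mxrank_coker subn_eq0 -ltnNge ltnS.
  exact: rank_leq_row.
case/matrix0Pn => j0 [k jk].
apply: (@card_hyperplane F d n p (fun j => cokermx M j k) j0) => // y /LM.
rewrite submxE => /eqP/rowP/(_ k); rewrite !mxE => e; rewrite -[RHS]e.
by apply: eq_bigr => j _; rewrite [X in _ = X * _]mxE.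
Qed.

(** Resampling x_(d+1), confined to a space of dimension at most d-1, leaves n^(d-1) choices.
    Resampling x_d, confined to the hyperplane whose normal vector consists of the cofactors of the
    last row, leaves n^(d-2) times 1 plus a weight with bounded mean. *)
Lemma sum_bad_hyperplane_le (F : numFieldType) (e n T : nat) (d := e.+3) : (0 < n)%N ->
  (0 < T)%N -> tau_le (big_bound d n) T ->
  (n ^ d * (n ^ d * \sum_(X : config 'I_d.+2 'I_d n) bad_hyperplane F X) <=
   n ^ e.+2 * (n ^ e.+1 * (3 * weight_const T e.+2 * #|{: config 'I_d.+2 'I_d n}|)))%N.
Proof.
move=> n0 T0 tT.
pose N j (X : config 'I_d.+2 'I_d n) := cofactor (base_mx X) ord_max j.
pose k1 : 'I_d := lift ord0 ord0.
pose H (X : config 'I_d.+2 'I_d n) :=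
  (row_dif F ord0 X (base_rows ord_max) <= hyper_mx F X)%MS.
have step1 : (n ^ d * \sum_(X : config 'I_d.+2 'I_d n) bad_hyperplane F X <=
    \sum_(X : config 'I_d.+2 'I_d n) n ^ e.+2 * H X)%N.
  rewrite -[X in (n ^ X * _)%N]card_ord; apply: (sum_put_point (i := ord_max)) => X.
  have ME p : hyper_mx F (put_point ord_max X p) = hyper_mx F X.
    by apply: hyper_mx_put => // k; apply: base_rows_neq_max.
  pose L (y : {ffun 'I_d -> 'I_n}) :=
    ((\row_j ((y j)%:R - (X ord0 j)%:R) : 'rV[F]_d) <= hyper_mx F X)%MS.
  have bE p : bad_hyperplane F (put_point ord_max X p) = H X && L p.
    rewrite /bad_hyperplane ME !row_dif_put // eqxx.
    by rewrite eq_sym eq_sym (negbTE (base_rows_neq_max _)).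
  under eq_bigr => p _ do rewrite bE.
  case: (H X); last by rewrite big1.
  rewrite muln1 (sum_pred_card L).
  exact: (card_rowspace (M := hyper_mx F X) (p := X ord0)).
have step2 : (n ^ d * \sum_(X : config 'I_d.+2 'I_d n) H X <=
    \sum_(X : config 'I_d.+2 'I_d n)
       n ^ e.+1 * (1 + gcd_weight n e.+2 (N ord0 X) (N k1 X)))%N.
  rewrite -[X in (n ^ X * _)%N]card_ord; apply: (sum_put_point (i := base_rows ord_max)) => X.
  have ME p : hyper_mx F (put_point (base_rows ord_max) X p) = hyper_mx F X.
    apply: hyper_mx_put => // k; rewrite (inj_eq (@base_rows_inj _)).
    by rewrite eq_sym neq_lift.
  pose L (y : {ffun 'I_d -> 'I_n}) :=
    ((\row_j ((y j)%:R - (X ord0 j)%:R) : 'rV[F]_d) <= hyper_mx F X)%MS.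
  have bE p : H (put_point (base_rows ord_max) X p) = L p.
    by rewrite /H ME row_dif_put // eqxx.
  under eq_bigr => p _ do rewrite bE.
  rewrite (sum_pred_card L).
  have c1 : (#|L| <= n ^ e.+2)%N.
    exact: (card_rowspace (M := hyper_mx F X) (p := X ord0)).
  set W := gcd_weight _ _ _ _.
  have [Wn|nW] := leqP n W.
    by rewrite (leq_trans c1) // expnSr leq_mul2l (leq_trans Wn) ?leq_addl ?orbT.
  have N0 : N ord0 X != 0.
    by apply: contraTneq nW => N0; rewrite /W /gcd_weight N0 eqxx ltnn.
  have Ly y : L y -> shift_dot (X ord0) (N^~ X) y = 0.
    move=> yL; pose X' := put_point (base_rows ord_max) X y.
    have NX j : N j X' = N j X.
      apply: eq_cofactor => k l km _; rewrite !mxE dif_put_point //.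
      by rewrite (inj_eq (@base_rows_inj _)) (negbTE km).
    have -> : shift_dot (X ord0) (N^~ X) y = \det (base_mx X').
      rewrite (expand_det_row _ ord_max); apply: eq_bigr => j _.
      by rewrite -/(N j X') NX mxE dif_put_point // eqxx.
    (* All rows lie in the row space of [hyper_mx F X], whose rank is at most d-1, so the
       determinant vanishes. *)
    apply/eqP; rewrite -(intr_eq0 F) -det_map_mx -[_ == 0]negbK -unitfE -unitmxE.
    rewrite -row_free_unit -row_leq_rank -ltnNge.
    apply: (@leq_ltn_trans (\rank (hyper_mx F X))); last by rewrite ltnS rank_leq_row.
    apply/mxrankS/row_subP => i.
    have rE : row i (map_mx intr (base_mx X')) = row_dif F ord0 X' (base_rows i).
      by apply/rowP => j; rewrite !mxE rmorphB.
    rewrite rE; case: (unliftP ord_max i) => [i'|] ->.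
      rewrite -(ME y).
      by rewrite -(rowK (fun i => row_dif F ord0 X' (base_rows (lift ord_max i)))) row_sub.
    by rewrite row_dif_put // eqxx.
  apply: leq_trans (card_hyperplane_gcd (v := N^~ X) N0 Ly) _.
  rewrite leq_mul2l; apply/orP; right; rewrite add1n ltnS.
  rewrite /W /gcd_weight (negbTE N0) leq_min leq_div /=.
  have N0' : (0 < `|N ord0 X|)%N by rewrite absz_gt0.
  rewrite divn_quotient ?dvdn_gcdl // leq_div2r //.
  by rewrite -[X in (X <= _)%N]expn1 leq_pexp2l.
apply: leq_trans (_ : n ^ d * (n ^ e.+2 * \sum_(X : config 'I_d.+2 'I_d n) H X) <= _)%N.
  by rewrite leq_mul2l (leq_trans step1) ?orbT // big_distrr.
rewrite mulnCA leq_mul2l; apply/orP; right; apply: leq_trans step2 _.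
rewrite -big_distrr leq_mul2l; apply/orP; right; rewrite big_split /= sum1_card.
have nB k : (k <= e.+2)%N -> (k`! * n ^ k <= big_bound d n)%N.
  by move=> kd; apply: fact_exp_le_bound => //; apply: leqW.
have i1 : injective (@base_rows d \o lift ord_max) by move=> i j /base_rows_inj/lift_inj.
have WB := weight_bound (J := 'I_d) (o := (ord0 : 'I_d.+2)) n0 T0 nB tT.
have := two_weight_bound n0 (nB _ (leqnn _)) WB i1 (@inj_id 'I_d) (fun i => isT).
rewrite -/(weight_const T e.+2); set Om := #|_| => TW.
have SW : (\sum_X gcd_weight n e.+2 (N ord0 X) (N k1 X) <= 2 * weight_const T e.+2 * Om)%N.
  apply: leq_trans TW; apply/eq_leq/eq_bigr => X _.
  by apply: eq_gcd_weight; rewrite -[N _ X]/(last_cof _ _ _ _ _) abs_last_cof.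
have W0 : (0 < weight_const T e.+2)%N by rewrite expn_gt0 muln_gt0 expn_gt0 T0.
apply: leq_trans (leq_add (leqnn _) SW) _.
have -> : (3 * weight_const T e.+2 * Om =
    weight_const T e.+2 * Om + 2 * weight_const T e.+2 * Om)%N.
  by ring.
by rewrite leq_add2r leq_pmull.
Qed.

(** A random tuple is bad with probability n^(-3+o(1)). Here 55 = 11 (1 + 4) comes from the spheres
    and 3 from the hyperplanes. *)
Lemma sum_bad_le (F : numFieldType) (e n T : nat) (d := e.+3) : (0 < n)%N ->
  (0 < T)%N -> tau_le (big_bound d n) T ->
  (n ^ 3 * \sum_(X : config 'I_d.+2 'I_d n) (bad_sphere X || bad_hyperplane F X) <=
   (55 * (2 * d.+1).+1 ^ d + 3) * (T ^ 2 * weight_const T d) *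
     #|{: config 'I_d.+2 'I_d n}|)%N.
Proof.
move=> n0 T0 tT; set Om := #|_|; set M := weight_const T d; set C := (_ ^ d)%N.
have M0 : (0 < M)%N by rewrite expn_gt0 muln_gt0 expn_gt0 T0.
have T2 : (0 < T ^ 2)%N by rewrite expn_gt0 T0.
have Sph : (n ^ 3 * \sum_(X : config 'I_d.+2 'I_d n) bad_sphere X <=
    55 * C * (T ^ 2 * M) * Om)%N.
  have ne0 : (0 < n ^ e)%N by rewrite expn_gt0 n0.
  rewrite -(leq_pmul2l ne0) mulnA -expnD addn3; apply: leq_trans (sum_bad_sphere_le n0 T0 tT) _.
  rewrite -!big_distrr /= leq_mul2l; apply/orP; right; rewrite big_split /= sum1_card -/C.
  apply: leq_trans (leq_mul (leqnn _) (leq_add (leqnn _) (sum_center_weight_le n0 T0 tT))) _.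
  rewrite -/M -/Om.
  have -> : (55 * C * (T ^ 2 * M) * Om = 11 * T ^ 2 * C * (M * Om + 4 * M * Om))%N by ring.
  by rewrite leq_mul2l leq_add2r leq_pmull ?orbT.
have Hyp : (n ^ 3 * \sum_(X : config 'I_d.+2 'I_d n) bad_hyperplane F X <=
    3 * (T ^ 2 * M) * Om)%N.
  have ne0 : (0 < n ^ e.+2 * n ^ e.+1)%N by rewrite muln_gt0 !expn_gt0 n0.
  rewrite -(leq_pmul2l ne0).
  have -> : (n ^ e.+2 * n ^ e.+1 * (n ^ 3 * \sum_(X : config 'I_d.+2 'I_d n) bad_hyperplane F X) =
      n ^ d * (n ^ d * \sum_(X : config 'I_d.+2 'I_d n) bad_hyperplane F X))%N.
    have h : (n ^ e.+2 * n ^ e.+1 * n ^ 3 = n ^ d * n ^ d)%N.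
      by rewrite -!expnD; congr expn; rewrite /d; lia.
    by rewrite mulnA h mulnA.
  apply: leq_trans (sum_bad_hyperplane_le F n0 T0 tT) _.
  rewrite mulnA leq_mul2l; apply/orP; right; rewrite -/Om leq_mul2r; apply/orP; right.
  rewrite leq_mul2l /= [M]expnS (leq_trans _ (leq_pmull _ T2)) // leq_pmull //.
  by rewrite muln_gt0 expn_gt0 T0.
rewrite mulnDl mulnDl; apply: leq_trans (leq_add Sph Hyp).
rewrite -mulnDr leq_mul2l -big_split /=; apply/orP; right.
by apply: leq_sum => X _; case: (bad_sphere X) => //=; rewrite leq_addr.
Qed.

(** * Ordering the points of a cospherical or cohyperplanar set *)

Lemma perm_extend (m k : nat) (a b : 'I_k -> 'I_m) : injective a -> injective b ->
  exists s : 'S_m, forall i, s (a i) = b i.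
Proof.
elim: k a b => [|k IH] a b ia ib; first by exists 1%g => -[].
have [s sab] := IH _ _ (inj_comp ia (@lift_inj _ ord_max)) (inj_comp ib (@lift_inj _ ord_max)).
exists (s * tperm (s (a ord_max)) (b ord_max))%g => i; rewrite permM.
case: (unliftP ord_max i) => [j|] ->; last by rewrite tpermL.
have := sab j; rewrite /= => sj; rewrite tpermD -?sj //.
  by rewrite (inj_eq perm_inj) (inj_eq ia) neq_lift.
by rewrite sj (inj_eq ib) neq_lift.
Qed.

(** A rank-sized family of rows spans the row space, and a permutation carries the positions listed
    by [g] onto it. *)
Lemma perm_rowspan (F : fieldType) (m k p : nat) (A : 'M[F]_(m, p)) (g : 'I_k -> 'I_m) :
  injective g -> (\rank A <= k)%N ->
  exists s : 'S_m, (A <= rowsub (s \o g) A)%MS.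
Proof.
move=> ig rk; have ig' : injective (g \o widen_ord rk).
  by move=> i j /ig /(congr1 val) /= /val_inj.
have [s sP] := perm_extend ig' (@maxrankfun_inj _ _ _ A).
exists s; rewrite -(eq_maxrowsub A); apply/row_subP => i.
rewrite row_rowsub -sP.
have -> : row (s ((g \o widen_ord rk) i)) A = row (widen_ord rk i) (rowsub (s \o g) A).
  by rewrite row_rowsub.
exact: row_sub.
Qed.

(** The vector [c] is twice the center relative to x_0. By Cramer's rule the equations for x_1, ...,
    x_d give D c = [center_num], and the one for x_(d+1) becomes the integer equation. *)
Lemma bad_of_cospherical (F : numFieldType) (d n : nat) (X : config 'I_d.+2 'I_d n)
    (c : 'I_d -> F) :
  (forall i, \sum_j ((X i j)%:R - (X ord0 j)%:R) ^+ 2 =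
     \sum_j ((X i j)%:R - (X ord0 j)%:R) * c j) ->
  \det (base_mx X) != 0 -> bad_sphere X.
Proof.
move=> Xc D0; rewrite /bad_sphere D0 /=.
set Z := base_mx X in D0 *; pose f : {rmorphism int -> F} := intr.
have f_inj : injective f by exact: intr_inj.
have fn (m k : nat) : f (m%:Z - k%:Z) = m%:R - k%:R by rewrite rmorphB.
pose cv : 'cV[F]_d := \col_j c j.
have Zc : map_mx f Z *m cv = map_mx f (sq_col Z).
  apply/colP => i; rewrite !mxE rmorph_sum.
  transitivity (\sum_j ((X (base_rows i) j)%:R - (X ord0 j)%:R) * c j).
    by apply: eq_bigr => j _; rewrite mxE mxE [cv _ _]mxE fn.
  by rewrite -Xc; apply: eq_bigr => j _; rewrite rmorphXn /= mxE fn.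
have Dc : map_mx f (center_num Z) = f (\det Z) *: cv.
  rewrite /center_num map_mxM -Zc mulmxA map_mx_adj mul_adj_mx mul_scalar_mx.
  by rewrite det_map_mx.
apply/eqP/f_inj; rewrite rmorphM [X in _ * X]rmorph_sum [RHS]rmorph_sum.
transitivity (f (\det Z) * \sum_j ((X ord_max j)%:R - (X ord0 j)%:R) * c j).
  rewrite -Xc; congr (_ * _); apply: eq_bigr => j _; by rewrite rmorphXn fn.
rewrite mulr_sumr; apply: eq_bigr => j _; rewrite rmorphM fn mulrCA; congr (_ * _).
by have /colP/(_ j) := Dc; rewrite !mxE => <-.
Qed.

(* Order the points so that the first rank-many rows of the difference matrix span its row
   space: full rank leads to bad_sphere, smaller rank to bad_hyperplane. *)
Lemma exists_bad_order (F : numFieldType) (e n : nat) (d := e.+3)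
    (X : config 'I_d.+2 'I_d n) :
  (exists c : 'I_d -> F, forall i, \sum_j ((X i j)%:R - (X ord0 j)%:R) ^+ 2 =
     \sum_j ((X i j)%:R - (X ord0 j)%:R) * c j) \/
  (exists2 a : 'I_d -> F, exists k, a k != 0 &
     forall i, \sum_j ((X i j)%:R - (X ord0 j)%:R) * a j = 0) ->
  exists2 s : 'S_d.+2, s ord0 = ord0 &
    let Y := [ffun i => X (s i)] : config 'I_d.+2 'I_d n in
    bad_sphere Y || bad_hyperplane F Y.
Proof.
move=> sph_hyp; pose Z : 'M[F]_(d.+1, d) := \matrix_i row_dif F ord0 X (lift ord0 i).
pose Y (s : 'S_d.+1) : config 'I_d.+2 'I_d n := [ffun i => X (lift0_perm s i)].
have s0 (s : 'S_d.+1) : lift0_perm s ord0 = ord0 by rewrite lift_perm_id.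
have rowY s i : row_dif F ord0 (Y s) (lift ord0 i) = row (s i) Z.
  rewrite rowK; apply/rowP => j; rewrite !mxE !ffunE s0.
  by rewrite lift_perm_lift.
have [rk|rk] := ltnP (\rank Z) d.
  pose g (i : 'I_e.+2) : 'I_d.+1 := lift ord_max (lift ord_max i).
  have ig : injective g by move=> i j /lift_inj/lift_inj.
  have [s sP] := perm_rowspan (A := Z) ig rk.
  have ME : hyper_mx F (Y s) = rowsub (s \o g) Z.
    by apply/row_matrixP => i; rewrite rowK row_rowsub /base_rows rowY.
  exists (lift0_perm s) => //; apply/orP; right; rewrite -/(Y s) /bad_hyperplane ME.
  have rs i : (row_dif F ord0 (Y s) (lift ord0 i) <= rowsub (s \o g) Z)%MS.
    by rewrite rowY; apply: submx_trans sP; exact: row_sub.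
  rewrite /base_rows rs /=.
  by have -> : ord_max = lift ord0 ord_max :> 'I_d.+2 by apply: val_inj.
have [s sP] := perm_rowspan (A := Z) (@lift_inj _ ord_max) (rank_leq_col Z).
exists (lift0_perm s) => //; apply/orP; left; rewrite -/(Y s).
(* Full column rank excludes the hyperplane case, whose normal vector would be a nonzero element of
   the kernel. *)
case: sph_hyp => [[c Xc]|[a [k ak] Xa]]; last first.
  have Za : Z *m \col_j a j = 0.
    apply/colP => i; rewrite !mxE -[RHS](Xa (lift ord0 i)).
    by apply: eq_bigr => j _; rewrite !mxE.
  have fullZ : row_full Z by rewrite -col_leq_rank.
  have /colP/(_ k) : \col_j a j = 0 by apply: (row_full_inj fullZ); rewrite Za mulmx0.
  by rewrite !mxE => /eqP; rewrite (negbTE ak).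
apply: (@bad_of_cospherical F _ _ _ c) => [i|].
  by rewrite !ffunE s0 Xc.
rewrite -(intr_eq0 F) -det_map_mx -unitfE -unitmxE -row_full_unit -col_leq_rank.
apply: leq_trans rk _; apply: mxrankS; apply: submx_trans sP _.
rewrite (_ : rowsub _ Z = map_mx intr (base_mx (Y s))) //.
apply/row_matrixP => i; rewrite row_rowsub -rowY; apply/rowP => j.
by rewrite !mxE rmorphB.
Qed.

(** * Deletion *)

(** Colours are chosen independently, so a fixed set [S] is entirely of colour 0 with probability
    (N+1)^(-|S|). *)
Lemma count_colorings (V : finType) (N : nat) (S : {set V}) :
  (N.+1 ^ #|S| * #|[pred f : {ffun V -> 'I_N.+1} | [forall x in S, f x == ord0]]|
     = N.+1 ^ #|V|)%N.
Proof.
have -> : (#|[pred f : {ffun V -> 'I_N.+1} | [forall x in S, f x == ord0]]| =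
    \prod_(x : V) \sum_(c < N.+1) ((x \in S) ==> (c == ord0)))%N.
  rewrite bigA_distr_bigA /= -sum1_card big_mkcond; apply: eq_bigr => f _.
  rewrite inE; case: (boolP [forall x in S, _]) => [/forallP Sf|/forallPn[x Sx]].
    by rewrite big1 // => x _; rewrite Sf.
  by rewrite (bigD1 x) //= (negbTE Sx).
have -> : (\prod_(x : V) \sum_(c < N.+1) ((x \in S) ==> (c == ord0)) =
    \prod_(x in ~: S) N.+1)%N.
  rewrite [RHS]big_mkcond; apply: eq_bigr => x _; rewrite inE /=.
  case: (x \in S) => /=; last by rewrite sum_nat_const card_ord muln1.
  by rewrite (bigD1 ord0) //= big1 // => c /negbTE ->.
by rewrite prod_nat_const -expnD cardsC.
Qed.

(* Remove one point of each bad set contained in a colour class of a random colouring. *)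
Lemma exists_large_subset_avoiding (V : finType) (k N : nat) (Bad : {set {set V}}) : (0 < N)%N ->
  (forall S, S \in Bad -> #|S| = k.+1) ->
  (2 * #|Bad| <= N ^ k * #|V|)%N ->
  exists A : {set V}, (#|V| <= 2 * N * #|A|)%N /\ forall S, S \in Bad -> ~~ (S \subset A).
Proof.
case: N => // N _ Badk cBad.
pose pts (f : {ffun V -> 'I_N.+1}) := [set x | f x == ord0].
pose bad (f : {ffun V -> 'I_N.+1}) := [set S in Bad | S \subset pts f].
have count (S : {set V}) : (\sum_f (S \subset pts f) =
    #|[pred f : {ffun V -> 'I_N.+1} | [forall x in S, f x == ord0]]|)%N.
  rewrite -sum1_card [RHS]big_mkcond; apply: eq_bigr => f _; rewrite inE.
  rewrite (_ : _ \subset _ = [forall x in S, f x == ord0]); first by case: [forall x in S, _].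
  apply/idP/idP => [/subsetP h|/forall_inP h].
    by apply/forall_inP => x /h; rewrite inE.
  by apply/subsetP => x /h; rewrite inE.
have sum_pts : (N.+1 * \sum_f #|pts f| = #|V| * N.+1 ^ #|V|)%N.
  rewrite (eq_bigr (fun f => \sum_x ([set x] \subset pts f))%N); last first.
    move=> f _; rewrite -sum1_card big_mkcond; apply: eq_bigr => x _.
    by rewrite sub1set; case: (x \in _).
  rewrite exchange_big big_distrr /= -sum_nat_const; apply: eq_bigr => x _.
  by rewrite count -(count_colorings N [set x]) cards1 expn1.
have sum_bad : (N.+1 ^ k.+1 * \sum_f #|bad f| = #|Bad| * N.+1 ^ #|V|)%N.
  rewrite (eq_bigr (fun f => \sum_(S in Bad) (S \subset pts f))%N); last first.
    move=> f _; rewrite -sum1_card big_mkcond [RHS]big_mkcond; apply: eq_bigr => S _.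
    by rewrite inE; case: (S \in Bad) => //=; case: (S \subset _).
  rewrite exchange_big big_distrr /= -sum_nat_const; apply: eq_bigr => S BS.
  by rewrite count -(count_colorings N S) Badk.
have bad_pts : (2 * \sum_f #|bad f| <= \sum_f #|pts f|)%N.
  have Nk : (0 < N.+1 ^ k.+1)%N by rewrite expn_gt0.
  rewrite -(leq_pmul2l Nk) mulnCA sum_bad.
  have -> : (N.+1 ^ k.+1 * \sum_f #|pts f| = N.+1 ^ k * (#|V| * N.+1 ^ #|V|))%N.
    by rewrite -sum_pts expnSr mulnA.
  by rewrite !mulnA leq_mul2r cBad orbT.
(* On average over colourings the right side equals 2 |V|, and the last term on the left is at most
   |V|; some colouring does at least as well. *)
have [f fP] : exists f, (#|V| + 2 * N.+1 * #|bad f| <= 2 * N.+1 * #|pts f|)%N.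
  apply/existsP; rewrite -[X in is_true X]negbK negb_exists; apply/negP => /forallP h.
  have [c cE] : exists c, c = (2 * N.+1)%N by exists (2 * N.+1)%N.
  rewrite -cE in h.
  have : (\sum_f (c * #|pts f| + 1) <= \sum_f (#|V| + c * #|bad f|))%N.
    by apply: leq_sum => f _; rewrite addn1 ltnNge.
  rewrite !big_split /= -!big_distrr /= !sum_nat_const card_ffun card_ord muln1.
  have : (0 < N.+1 ^ #|V|)%N by rewrite expn_gt0.
  have : (c * \sum_f #|bad f| <= N.+1 * \sum_f #|pts f|)%N.
    by rewrite cE mulnAC mulnC leq_mul2l bad_pts.
  have -> : (c * \sum_f #|pts f| = 2 * (N.+1 * \sum_f #|pts f|))%N by rewrite cE mulnA.
  rewrite sum_pts [(#|V| * _)%N]mulnC => h1 h2; apply/negP; rewrite -ltnNge.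
  apply: leq_ltn_trans (leq_add (leqnn _) h1) _.
  by rewrite mul2n -addnn -[X in (X < _)%N]addn0 ltn_add2l.
pose pk (S : {set V}) : option V := [pick x in S].
pose A := [set x in pts f | [forall S in bad f, pk S != Some x]].
exists A; split.
  have cA : (#|pts f| <= #|A| + #|bad f|)%N.
    rewrite -(cardsID A (pts f)) leq_add ?subset_leq_card ?subsetIr //.
    rewrite -(card_imset _ (@Some_inj _)).
    apply: leq_trans (leq_imset_card pk (bad f)); apply: subset_leq_card.
    apply/subsetP => _ /imsetP[x + ->]; rewrite !inE => /andP[xA xf].
    move: xA; rewrite xf /= => /forall_inPn[S Sb /negbNE/eqP <-].
    exact: imset_f.
  rewrite -(leq_add2r (2 * N.+1 * #|bad f|)%N) (leq_trans fP) // -mulnDr.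
  by rewrite leq_mul2l cA orbT.
move=> S BS; apply/negP => SA.
have Sb : S \in bad f.
  by rewrite inE BS (subset_trans SA) //; apply/subsetP => x; rewrite inE => /andP[].
have [y yS pkS] : exists2 y, y \in S & pk S = Some y.
  rewrite /pk; case: pickP => [y yS|S0]; first by exists y.
  by have := Badk S BS; rewrite eq_card0.
have := subsetP SA y yS; rewrite inE => /andP[_ /forall_inP/(_ S Sb)].
by rewrite pkS eqxx.
Qed.

(** The least N with Q <= q N^(p+1): minimality bounds N - 1, and N <= 2 (N - 1) unless N = 1, where
    q <= Q is used. *)
Lemma exists_root_above (p q Q : nat) : (0 < q)%N -> (q <= Q)%N ->
  exists N, [/\ (0 < N)%N, (Q <= q * N ^ p.+1)%N & (q * N ^ p.+1 <= 2 ^ p.+1 * Q)%N].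
Proof.
move=> q0 qQ.
have ex : exists N, (0 < N)%N && (Q <= q * N ^ p.+1)%N.
  exists Q; rewrite (leq_trans q0 qQ) /= expnS mulnCA leq_pmulr //.
  by rewrite muln_gt0 q0 expn_gt0 (leq_trans q0 qQ).
case: (ex_minnP ex) => N /andP[N0 QN] minN; exists N; split=> //.
case: N N0 QN minN => // -[|N] _ QN minN.
  by rewrite exp1n muln1 (leq_trans qQ) // leq_pmull // expn_gt0.
have : (q * N.+1 ^ p.+1 < Q)%N.
  by rewrite ltnNge; apply/negP => h; have := minN N.+1; rewrite h => /(_ isT); rewrite ltnn.
move/ltnW => h; apply: (@leq_trans (q * (2 * N.+1) ^ p.+1)%N).
  by rewrite leq_mul2l leq_exp2r // mul2n -addnn addSn addnS !ltnS leq_addl orbT.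
by rewrite expnMn mulnCA leq_mul2l h orbT.
Qed.

Definition config_image (I J : finType) n (X : config I J n) : {set {ffun J -> 'I_n}} :=
  [set X i | i in I].

(** There are at most as many bad sets as bad tuples, namely K n^(d(d+2)-3). The colouring therefore
    uses N colours with N^(d+1) about 2 K n^(d(d+1)-3), and |A| >= n^d / (2 N) is raised to the
    power d+1. *)
Lemma exists_large_good_set (F : numFieldType) (e n T : nat) (d := e.+3) : (0 < n)%N ->
  (0 < T)%N -> tau_le (big_bound d n) T ->
  exists A : {set {ffun 'I_d -> 'I_n}},
    (n ^ 3 <= 2 ^ (2 * d + 3) * ((55 * (2 * d.+1).+1 ^ d + 3) * (T ^ 2 * weight_const T d)) *
       #|A| ^ d.+1)%N /\
    forall X : config 'I_d.+2 'I_d n, config_image X \subset A -> #|config_image X| = d.+2 ->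
      ~~ (bad_sphere X || bad_hyperplane F X).
Proof.
move=> n0 T0 tT; set K := ((55 * _ + 3) * _)%N.
have K0 : (0 < K)%N.
  by rewrite /K /weight_const !(muln_gt0, addn_gt0, expn_gt0, T0, orbT).
pose badc (X : config 'I_d.+2 'I_d n) := bad_sphere X || bad_hyperplane F X.
pose Bad := [set S in [set config_image X | X in badc] | #|S| == d.+2].
have cOm : #|{: config 'I_d.+2 'I_d n}| = (n ^ (d * d.+2))%N.
  by rewrite !card_ffun !card_ord -expnM.
have cBad : (n ^ 3 * #|Bad| <= K * n ^ (d * d.+2))%N.
  rewrite -cOm; apply: leq_trans (sum_bad_le F n0 T0 tT); rewrite leq_mul2l.
  apply/orP; right; rewrite (sum_pred_card badc).
  apply: (@leq_trans #|[set config_image X | X in badc]|); last exact: leq_imset_card.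
  apply: subset_leq_card.
  by apply/subsetP => S; rewrite in_set => /andP[].
have n3 : (n ^ 3 <= 2 * K * n ^ (d * d.+1))%N.
  apply: (@leq_trans (n ^ (d * d.+1))%N); last by rewrite leq_pmull // muln_gt0.
  by rewrite leq_pexp2l // /d; lia.
have n30 : (0 < n ^ 3)%N by rewrite expn_gt0 n0.
have [N [N0 N1 N2]] := exists_root_above d n30 n3.
have Bk S : S \in Bad -> #|S| = d.+2 by rewrite inE => /andP[_ /eqP].
have BN : (2 * #|Bad| <= N ^ d.+1 * #|{ffun 'I_d -> 'I_n}|)%N.
  rewrite card_ffun !card_ord -(leq_pmul2l n30) mulnCA.
  apply: (@leq_trans (2 * (K * n ^ (d * d.+2))))%N; first by rewrite leq_mul2l cBad.
  have -> : (d * d.+2 = d * d.+1 + d)%N by rewrite mulnS addnC.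
  rewrite (expnD n (d * d.+1) d) (mulnA (n ^ 3)%N) (mulnA K) (mulnA 2) (mulnA 2 K).
  exact: leq_mul N1 (leqnn _).
have [A [cA goodA]] := exists_large_subset_avoiding N0 Bk BN; exists A; split; last first.
  move=> X XA cX; apply/negP => bX; have := goodA (config_image X).
  rewrite XA inE cX eqxx andbT => /(_ _)/negP; apply => //.
  by apply: imset_f.
rewrite card_ffun !card_ord in cA.
have nd0 : (0 < n ^ (d * d.+1))%N by rewrite expn_gt0 n0.
rewrite -(leq_pmul2l nd0).
have : (n ^ (d * d.+1) <= 2 ^ d.+1 * N ^ d.+1 * #|A| ^ d.+1)%N.
  by rewrite expnM -!expnMn leq_exp2r.
move=> h; rewrite mulnC; apply: leq_trans (leq_mul (leqnn _) h) _.
have -> : (n ^ 3 * (2 ^ d.+1 * N ^ d.+1 * #|A| ^ d.+1) =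
    2 ^ d.+1 * #|A| ^ d.+1 * (n ^ 3 * N ^ d.+1))%N by ring.
apply: leq_trans (leq_mul (leqnn _) N2) _; apply: eq_leq.
have -> : (2 * d + 3 = d.+1 + d.+1 + 1)%N by lia.
by rewrite !expnD expn1; ring.
Qed.

Lemma large_good_set_asymptotic (F : numFieldType) (e k : nat) (d := e.+3) : (0 < k)%N ->
  exists C m, [/\ (0 < C)%N, (0 < m)%N & forall n, (0 < n)%N ->
    exists A : {set {ffun 'I_d -> 'I_n}},
    (n ^ (3 * (m * k)) <= C * n ^ m * #|A| ^ (d.+1 * (m * k)))%N /\
    forall X : config 'I_d.+2 'I_d n, config_image X \subset A -> #|config_image X| = d.+2 ->
      ~~ (bad_sphere X || bad_hyperplane F X)].
Proof.
(* l is the exponent of T in [T ^ 2 * weight_const T d] and m that of n in [big_bound]. The divisor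
   bound with exponent l m k makes the (m k)-th power of T^l at most a constant times n^m. *)
move=> k0; pose m := (2 * d + 4)%N; pose l := (4 * d + 2)%N.
have kk0 : (0 < l * (m * k))%N by rewrite !muln_gt0 k0 /l /m; lia.
have [Ct Ct0 tauC] := tau_bound kk0.
pose c1 := (2 ^ (2 * d + 3) * ((55 * (2 * d.+1).+1 ^ d + 3) * 100 ^ d))%N.
pose c2 := (18 * d ^ 4 * d`! ^ 2)%N.
have c10 : (0 < c1)%N by rewrite !(muln_gt0, addn_gt0, expn_gt0, orbT).
have c20 : (0 < c2)%N by rewrite !(muln_gt0, expn_gt0, fact_gt0).
exists (c1 ^ (m * k) * (Ct * c2))%N, m; split.
  by rewrite muln_gt0 expn_gt0 c10 (muln_gt0 Ct) Ct0.
  by rewrite /m; lia.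
move=> n n0; pose B := big_bound d n.
have BE : B = (c2 * n ^ m)%N.
  rewrite /B /big_bound /c2 /m expnMn -expnM expnD [(2 * d)%N]mulnC; ring.
pose T := (\max_(i < B.+1) tau i)%N.
have tT : tau_le B T.
  by move=> i /andP[i0 iB]; apply: (leq_bigmax (F := fun i : 'I_B.+1 => tau i)
    (Ordinal (iB : i < B.+1)%N)).
have B0 : (0 < B)%N by rewrite BE muln_gt0 c20 expn_gt0 n0.
have T0 : (0 < T)%N by apply: leq_trans (tT 1%N _); rewrite ?tau_gt0 // B0.
have TB : (T ^ (l * (m * k)) <= Ct * B)%N.
  have oB : (0 < #|'I_B.+1|)%N by rewrite card_ord.
  have [i Ti] := bigop.eq_bigmax (fun i : 'I_B.+1 => tau i) oB; rewrite -/T in Ti.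
  (* The maximum may be attained at the index 0, where [tau 0 = 1]. *)
  have [i0|i0] := posnP i; last first.
    by rewrite Ti (leq_trans (tauC _ i0)) // leq_mul2l -ltnS ltn_ord orbT.
  by rewrite Ti i0 (_ : tau 0 = 1)%N // exp1n muln_gt0 Ct0 B0.
have [A [nA goodA]] := exists_large_good_set F n0 T0 tT; exists A; split=> //.
have K1 : (n ^ 3 <= c1 * T ^ l * #|A| ^ d.+1)%N.
  have WE : weight_const T d = (100 ^ d * T ^ (4 * d))%N by rewrite /weight_const expnMn -expnM.
  have TE : (T ^ l = T ^ (4 * d) * T ^ 2)%N by rewrite -expnD.
  apply: leq_trans nA (eq_leq _); congr (_ * _)%N; rewrite WE TE /c1.
  move: (55 * _ + 3)%N (2 ^ (2 * d + 3))%N (T ^ 2)%N (100 ^ d)%N (T ^ (4 * d))%N => x1 x2 x3 x4 x5.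
  by ring.
rewrite expnM; apply: (@leq_trans ((c1 * T ^ l * #|A| ^ d.+1) ^ (m * k))%N).
  by rewrite leq_exp2r // muln_gt0 k0 /m; lia.
rewrite (expnMn (c1 * T ^ l)%N) (expnMn c1) -(expnM T) -(expnM #|A|) leq_mul //.
by rewrite -(mulnA (c1 ^ _)%N) leq_mul // -(mulnA Ct) -BE.
Qed.

From mathcomp Require Import all_classical all_reals all_analysis.
Import numFieldNormedType.Exports.
Local Open Scope classical_set_scope.
Local Open Scope ring_scope.

(** * The asymptotic statement *)

Lemma good_of_config (R : realType) (e n : nat) (d := e.+3) (A : {set cube_pt d n}) :
  (forall X : config 'I_d.+2 'I_d n, config_image X \subset A ->
     #|config_image X| = d.+2 -> ~~ (bad_sphere X || bad_hyperplane R X)) ->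
  no_cospherical R A /\ no_cohyperplanar R A.
Proof.
move=> good.
have dif_embed (x y : cube_pt d n) j : embed R x 0 j - embed R y 0 j = (x j)%:R - (y j)%:R.
  by rewrite !mxE -addn1 -[(y j).+1]addn1 !natrD; ring.
have key (S : {set cube_pt d n}) : S \subset A -> #|S| = (d + 2)%N ->
    exists X : config 'I_d.+2 'I_d n, (forall i, X i \in S) /\
    (((exists c : 'I_d -> R, forall i, \sum_j ((X i j)%:R - (X ord0 j)%:R) ^+ 2 =
       \sum_j ((X i j)%:R - (X ord0 j)%:R) * c j) \/
      (exists2 a : 'I_d -> R, exists k, a k != 0 &
       forall i, \sum_j ((X i j)%:R - (X ord0 j)%:R) * a j = 0)) -> False).
  rewrite addn2 => SA cS.
  have e_lt (i : 'I_d.+2) : (i < #|S|)%N by rewrite cS.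
  pose X : config 'I_d.+2 'I_d n := [ffun i => enum_val (Ordinal (e_lt i))].
  have XS i : X i \in S by rewrite ffunE enum_valP.
  exists X; split => // /exists_bad_order[s _] /=.
  set Y : config _ _ _ := [ffun i => X (s i)] => badY.
  have Yinj : injective Y.
    by move=> i j; rewrite !ffunE => /enum_val_inj[] /val_inj/perm_inj.
  have cY : #|config_image Y| = d.+2 by rewrite card_imset // card_ord.
  have YA : config_image Y \subset A.
    apply: fintype.subset_trans SA; apply/fintype.subsetP => _ /imsetP[i _ ->].
    by rewrite ffunE XS.
  by have := good Y YA cY; rewrite badY.
split=> S SA cS.
  move=> [c [r [_ Sc]]]; have [X [XS]] := key S SA cS; apply; left.
  (* Subtracting the sphere equation at x_0 from that at x_i leaves |z_i|^2 = z_i . c, with c twice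
     the center relative to x_0. *)
  exists (fun j => 2 * (c 0 j - embed R (X ord0) 0 j)) => i.
  have := Sc _ (XS i); rewrite /on_sphere -(Sc _ (XS ord0)) => /eqP.
  rewrite -subr_eq0 -sumrB => /eqP Si; apply/eqP; rewrite -subr_eq0 -sumrB.
  apply/eqP; rewrite -[RHS]Si; apply: eq_bigr => j _; rewrite -dif_embed; ring.
move=> [a [b [a0 Sa]]]; have [X [XS]] := key S SA cS; apply; right.
exists (fun j => a 0 j).
  have /matrix0Pn[i [k ak]] := a0; exists k; by rewrite -(ord1 i).
move=> i; have := Sa _ (XS i); rewrite /on_hyperplane -(Sa _ (XS ord0)) => /eqP.
rewrite -subr_eq0 -sumrB => /eqP Si; rewrite -[RHS]Si.
by apply: eq_bigr => j _; rewrite -dif_embed; ring.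
Qed.

Definition good_set (R : realType) (d n : nat) (A : {set cube_pt d n}) : Prop :=
  no_cospherical R A /\ no_cohyperplanar R A.

(** The sets produced for different k differ; passing to the maximal size makes the bounds for all k
    hold for one quantity, from which a single epsilon is defined. *)
Definition max_good (R : realType) (d n : nat) : nat :=
  \max_(A : {set cube_pt d n} | `[< good_set R A >]) #|A|.

Lemma max_good_attained (R : realType) (d n : nat) :
  exists2 A : {set cube_pt d n}, good_set R A & #|A| = max_good R d n.
Proof.
have g0 : `[< good_set R (finset.set0 : {set cube_pt d n}) >].
  apply/asboolP; split=> S; rewrite finset.subset0 => /eqP ->; rewrite finset.cards0 addn2 //.
have c0 : (0 < #|[pred A : {set cube_pt d n} | `[< good_set R A >]]|)%N.
  by apply/card_gt0P; exists finset.set0.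
have [A gA AE] := bigop.eq_bigmax_cond (fun A : {set cube_pt d n} => #|A|) c0.
by exists A; [apply/asboolP | rewrite -AE].
Qed.

Lemma le_max_good (R : realType) (d n : nat) (A : {set cube_pt d n}) :
  good_set R A -> (#|A| <= max_good R d n)%N.
Proof.
move=> gA; apply: (bigop.leq_bigmax_cond (F := fun A : {set cube_pt d n} => #|A|)).
exact/asboolP.
Qed.

Lemma max_good_growth (R : realType) (d k : nat) : (3 <= d)%N -> (0 < k)%N ->
  exists C m, [/\ (0 < C)%N, (0 < m)%N & forall n, (0 < n)%N ->
    (n ^ (3 * (m * k)) <= C * n ^ m * max_good R d n ^ (d.+1 * (m * k)))%N].
Proof.
case: d => [|[|[|e]]] // _ k0.
have [C [m [C0 m0 H]]] := large_good_set_asymptotic R e k0.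
exists C, m; split=> // n n0; have [A [nA /good_of_config gA]] := H n n0.
apply: leq_trans nA _; rewrite leq_mul2l leq_exp2r ?le_max_good ?orbT //.
by rewrite !muln_gt0 m0 k0.
Qed.

(** With L = ln n and A = ln a, the assumption C <= n gives m k (3 L - (d+1) A) <= (1 + m) L <= 2 m
    L. *)
Lemma log_growth (R : realType) (d k n m C a : nat) : (0 < k)%N -> (0 < m)%N ->
  (1 < n)%N -> (C <= n)%N -> (0 < C)%N -> (0 < a)%N ->
  (n ^ (3 * (m * k)) <= C * n ^ m * a ^ (d.+1 * (m * k)))%N ->
  3 / d.+1%:R - ln a%:R / ln n%:R <= 2 / k%:R :> R.
Proof.
move=> k0 m0 n1 Cn C0 a0 H.
have n0 : (0 < n)%N by apply: ltn_trans n1.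
have L0 : 0 < ln n%:R :> R by rewrite ln_gt0 // ltr1n.
have : ln ((n ^ (3 * (m * k)))%:R) <= ln ((C * n ^ m * a ^ (d.+1 * (m * k)))%:R) :> R.
  rewrite ler_ln ?posrE ?ltr0n ?muln_gt0 ?expn_gt0 ?C0 ?n0 ?a0 //.
  by rewrite ler_nat.
rewrite !natrM !natrX !lnM ?posrE ?mulr_gt0 ?exprn_gt0 ?ltr0n // !lnXn ?ltr0n //.
set L := ln n%:R in L0 *; set A := ln a%:R; set lC := ln C%:R => H1.
have lCL : lC <= L by rewrite ler_ln ?posrE ?ltr0n // ler_nat.
have m1 : 1 <= m%:R :> R by rewrite ler1n.
have D1 : 1 <= d.+1%:R :> R by rewrite ler1n.
have K0 : 0 < k%:R :> R by rewrite ltr0n.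
have {}H1 : k%:R * (3 * L - d.+1%:R * A) <= 2 * L.
  have M0 : 0 < m%:R :> R by rewrite ltr0n.
  rewrite -(ler_pM2l M0); move: H1; rewrite -!(mulr_natr L) -(mulr_natr A) !natrM => H1.
  have h2 : L <= m%:R * L by rewrite ler_peMl // ltW.
  by lra.
have D0 : 0 < d.+1%:R :> R by rewrite ltr0n.
have -> : 3 / d.+1%:R - A / L = (3 * L - d.+1%:R * A) / (d.+1%:R * L).
  by field; rewrite !gt_eqF.
rewrite ler_pdivrMr ?mulr_gt0 // mulrAC ler_pdivlMr // mulrC (le_trans H1) //.
by rewrite ler_wpM2l // ler_peMl // ltW.
Qed.

Theorem theorem1p1 (R : realType) (d : nat) (hd : (3 <= d)%N) :
  exists eps : nat -> R,
    eps @ \oo --> 0 /\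
    forall n : nat, (0 < n)%N ->
      exists A : {set cube_pt d n},
        (n%:R `^ (3 / (d + 1)%:R - eps n) <= #|A|%:R) /\
        no_cospherical R A /\ no_cohyperplanar R A.
Proof.
pose a n := max_good R d n.
have a0 n : (0 < n)%N -> (0 < a n)%N.
  move=> n0; have [C [m [_ m0 /(_ n n0)]]] := max_good_growth R hd (ltn0Sn 0).
  rewrite -/(a n); case: (a n) => //; rewrite exp0n ?muln_gt0 ?m0 // muln0.
  by rewrite leqn0 expn_eq0 gtn_eqF.
(* The exact deficit of the exponent, cut off at 0: only an upper bound on the deficit is available,
   and a set larger than required is harmless. *)
exists (fun n => Num.max 0 (3 / d.+1%:R - ln (a n)%:R / ln n%:R)); split.
  apply/cvgrPdist_le => /= eps eps0.
  pose k := (Num.truncn (2 / eps)).+1.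
  have ke : 2 / k%:R <= eps.
    rewrite ler_pdivrMr ?ltr0n // mulrC -ler_pdivrMr // ltW //.
    by apply: truncnS_gt.
  have [C [m [C0 m0 H]]] := max_good_growth R hd (ltn0Sn (Num.truncn (2 / eps))).
  near=> n; rewrite sub0r normrN ger0_norm ?le_max ?lexx // ge_max ltW //=.
  have n1 : (1 < n)%N by near: n; exists 2%N.
  have Cn : (C <= n)%N by near: n; exists C.
  have n0 : (0 < n)%N by apply: ltn_trans n1.
  apply: le_trans ke; apply: (@log_growth R d k n m C (a n)) => //; first exact: a0.
  exact: H.
move=> n n0; have [A [gA1 gA2] cA] := max_good_attained R d n.
exists A; split=> //; rewrite cA -/(a n) addn1.
(* For n = 1 the logarithm in the denominator vanishes, but every power of 1 is 1. *)
have [n1|n1] := leqP n 1.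
  have -> : n = 1%N by apply/eqP; rewrite eqn_leq n1.
  by rewrite powR1 ler1n a0.
have L0 : 0 < ln n%:R :> R by rewrite ln_gt0 // ltr1n.
have aR : 0 < (a n)%:R :> R by rewrite ltr0n a0.
rewrite /powR gt_eqF ?ltr0n // -[leRHS]lnK ?posrE // ler_expR.
rewrite -ler_pdivlMr // lerBlDr -lerBlDl le_max lexx orbT //.
Unshelve. all: by end_near.
Qed.
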